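(* Consider the adaptive randomly reinforced urn (ARRU) described in the context. Assume that there exist constants $0<\rho_{\min}\le\rho_{\max}<1$ and $0<c_\rho<\infty$ such that, for all sufficiently large $n$, $$P\big(\rho_{\min}\le\hat\rho_{2,n}\le\hat\rho_{1,n}\le\rho_{\max}\big)\ \ge\ 1-\exp(-c_\rho n),$$ and that there exist constants $\rho_1,\rho_2\in(0,1)$ with $\rho_1\ge\rho_2$ such that $\hat\rho_{1,n}\to\rho_1$ and $\hat\rho_{2,n}\to\rho_2$ in probability. Then, when $m_1\neq m_2$, $Z_n\to\rho_1$ in probability if $m_1>m_2$, and $Z_n\to\rho_2$ in probability if $m_1<m_2$.
   Context: ARRU model. Let $0<a\le b<\infty$, let $S$ be a measurable space and $u:S\to[a,b]$ measurable. Let $\{\xi_{1,n}\}_{n\ge1}$ and $\{\xi_{2,n}\}_{n\ge1}$ be independent sequences of i.i.d. $S$-valued random variables with laws $\mu_1,\mu_2$; set $D_{j,n}=u(\xi_{j,n})$ and $m_j=\int u\,d\mu_j=E[D_{j,n}]$, $j=1,2$. Let $\{U_n\}_{n\ge1}$ be i.i.d. uniform on $(0,1)$, independent of the $\xi$'s and of auxiliary random variables $\varphi_1,\varphi_2,\dots$. The urn starts with $Y_{1,0}=y_{1,0}>0$ red and $Y_{2,0}=y_{2,0}>0$ white balls (real numbers); $y_0=y_{1,0}+y_{2,0}$, $Y_n=Y_{1,n}+Y_{2,n}$, $Z_n=Y_{1,n}/Y_n$. Let $\mathcal F_n=\sigma\big(X_1,X_1\xi_{1,1}+(1-X_1)\xi_{2,1},\dots,X_n,X_n\xi_{1,n}+(1-X_n)\xi_{2,n},\varphi_1,\dots,\varphi_n\big)$,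 with $U_{n+1}$ independent of $\mathcal F_n$ and of the $\xi$'s. The thresholds $\hat\rho_{1,n},\hat\rho_{2,n}$ are $[0,1]$-valued, $\mathcal F_n$-measurable, with $\hat\rho_{1,n}\ge\hat\rho_{2,n}$ a.s. For $n\ge0$: $X_{n+1}=\mathbf 1\{U_{n+1}\le Z_n\}$ (a red ball is drawn iff $X_{n+1}=1$), $W_{1,n}=\mathbf 1\{Z_n\le\hat\rho_{1,n}\}$, $W_{2,n}=\mathbf 1\{Z_n\ge\hat\rho_{2,n}\}$, and $Y_{1,n+1}=Y_{1,n}+X_{n+1}D_{1,n+1}W_{1,n}$, $Y_{2,n+1}=Y_{2,n}+(1-X_{n+1})D_{2,n+1}W_{2,n}$. *)

(* Defs.v *)
From HB Require Import structures.
From mathcomp Require Import all_boot all_order all_algebra.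
From mathcomp Require Import all_classical all_reals all_analysis.
Set Implicit Arguments. Unset Strict Implicit. Unset Printing Implicit Defensive.
Import Order.TTheory GRing.Theory Num.Theory.
Import numFieldNormedType.Exports.
Local Open Scope classical_set_scope.
Local Open Scope ring_scope.

Definition sigma_of d' (T : Type) (T' : measurableType d') (X : T -> T') :
  set (set T) := [set A | exists2 B, measurable B & A = X @^-1` B].

Definition mutually_independent d (T : measurableType d) (R : realType)
  (P : probability T R) (I : eqType) (G : I -> set (set T)) : Prop :=
  forall (J : seq I) (A : I -> set T), uniq J ->
    (forall i, i \in J -> G i (A i)) ->
    P (\big[setI/setT]_(i <- J) A i) = (\prod_(i <- J) fine (P (A i)))%:E.

Definition cvg_in_probability d (T : measurableType d) (R : realType)
  (P : probability T R) (Xs : nat -> T -> R) (c : R) : Prop :=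
  forall eps : R, 0 < eps ->
    (fun n => P [set w | eps <= `|Xs n w - c|]) @ \oo --> 0%E.

Section ARRU.
Variables (d dS : measure_display) (T : measurableType d)
  (S : measurableType dS) (R : realType).
Variables (u : S -> R) (xi1 xi2 : nat -> T -> S) (U : nat -> T -> R)
  (rho1hat rho2hat : nat -> T -> R) (y10 y20 : R).

(** urn composition (Y_{1,n}, Y_{2,n}); index n as in the paper,
    xi1 n, xi2 n, U n used only for n >= 1 *)
Fixpoint urnY (n : nat) (w : T) : R * R :=
  match n with
  | 0 => (y10, y20)
  | k.+1 =>
      let: (y1, y2) := urnY k w in
      let z := y1 / (y1 + y2) in
      let x := U k.+1 w <= z in
      (y1 + (if x && (z <= rho1hat k w) then u (xi1 k.+1 w) else 0),
       y2 + (if ~~ x && (rho2hat k w <= z) then u (xi2 k.+1 w) else 0))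
  end.

Definition urnY1 n w := (urnY n w).1.
Definition urnY2 n w := (urnY n w).2.
Definition urnZ n w := urnY1 n w / (urnY1 n w + urnY2 n w).

(** drawing indicator X_n (n >= 1): X_{n+1} = 1{U_{n+1} <= Z_n};
    X_0 is a dummy 0 *)
Definition urnX (n : nat) (w : T) : R :=
  match n with
  | 0 => 0
  | k.+1 => ((U k.+1 w <= urnZ k w)%R)%:R
  end.

(** X_n xi_{1,n} + (1 - X_n) xi_{2,n}: the observed ball-type variable *)
Definition urnObs (n : nat) (w : T) : S :=
  if urnX n w == 1 then xi1 n w else xi2 n w.

Variables (dF : measure_display) (Phi : measurableType dF)
  (phi : nat -> T -> Phi).

Definition urnF (n : nat) : set (set T) :=
  <<s \bigcup_(k in [set k | (1 <= k <= n)%N])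
        (sigma_of (urnX k) `|` sigma_of (urnObs k) `|` sigma_of (phi k)) >>.

End ARRU.

(* Main.v *)
Require Import Defs.
From HB Require Import structures.
From mathcomp Require Import all_boot all_order all_algebra.
From mathcomp Require Import all_classical all_reals all_analysis.
From mathcomp Require Import measurable_realfun.
From mathcomp Require Import ring lra zify.
Import Order.TTheory GRing.Theory Num.Theory.
Import numFieldNormedType.Exports.
Local Open Scope classical_set_scope.
Local Open Scope ring_scope.

(* Idea

Between times s and s + h, Y_1 grows by [sum Z_i D_{1,i+1} W_{1,i}] plus a
martingale term, and Y_2 likewise; hence
[Z_{s+h} - Z_s = ((1 - Z_s) dY_1 - Z_s dY_2) / Y_{s+h}].
With high probability the thresholds stay in [rho_min, rho_max] from some
time N on, so Z is then confined to some [p, 1 - p] and Y grows linearly.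
Cut [0, n] into K blocks of length h = n / K.  On each block the martingale
terms and the fluctuations of the sample means of D_1 and D_2 are o(h) in
probability (orthogonality and Chebyshev), and so is the number of times at which
a threshold is far from its limit (Cesaro and Markov).  If m_1 > m_2 and Z is below
rho_1 at the start of the j-th block, red is always replenished, and Z increases
by at least const / j; if Z is above rho_1, only white is replenished and Z
decreases by at least const / j.  As the harmonic series diverges, Z is near rho_1
at time n.  Exchanging the colours gives the case m_1 < m_2.

The auxiliary variables phi may depend on future xi.  This is harmless: only
the independence of U_{n+1} from (phi, xi, U_1, ..., U_n) is used for the
martingale terms, and no conditioning enters the sample means. *)

Set Implicit Arguments.
Unset Strict Implicit.
Unset Printing Implicit Defensive.

(** * Deterministic urn paths *)

Section path_definitions.
Variable R : realFieldType.

(* Step i leads from time i to time i + 1: d1 i is D_{1,i+1}, x i says that red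
   is drawn, and w1 i that a drawn red ball is replenished. *)
Record urn_path (a b : R) (y1 y2 d1 d2 : nat -> R) (x w1 w2 : nat -> bool) :
    Prop := UrnPath {
  path_a0 : 0 < a;
  path_y10 : 0 < y1 0%N;
  path_y20 : 0 < y2 0%N;
  path_d1 : forall i, a <= d1 i <= b;
  path_d2 : forall i, a <= d2 i <= b;
  path_y1 : forall i, y1 i.+1 = y1 i + (x i && w1 i)%:R * d1 i;
  path_y2 : forall i, y2 i.+1 = y2 i + (~~ x i && w2 i)%:R * d2 i }.

Definition frac (y1 y2 : nat -> R) (i : nat) : R := y1 i / (y1 i + y2 i).

(** The martingale part of [y1]: only the draw [x i] is centred, while the reinforcement [d1 i]
    stays random and is left to the compensator. *)
Definition noise (y1 y2 d1 : nat -> R) (x w1 : nat -> bool) (n : nat) : R :=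
  \sum_(0 <= i < n) ((x i)%:R - frac y1 y2 i) * d1 i * (w1 i)%:R.

(** The symmetry between colours: facts on [y1] transfer to [y2], and the case of a larger white
    mean reduces to that of a larger red one. *)
Lemma urn_path_swap a b y1 y2 d1 d2 x w1 w2 :
  urn_path a b y1 y2 d1 d2 x w1 w2 ->
  urn_path a b y2 y1 d2 d1 (fun i => ~~ x i) w2 w1.
Proof. by case=> *; split=> // i; rewrite negbK. Qed.

End path_definitions.

Section path_theory.
Variables (R : realFieldType) (a b : R) (y1 y2 d1 d2 : nat -> R).
Variables (x w1 w2 : nat -> bool).
Hypothesis Hp : urn_path a b y1 y2 d1 d2 x w1 w2.

Local Notation z := (frac y1 y2).
Local Notation y i := (y1 i + y2 i).

Lemma path_b_gt0 : 0 < b.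
Proof. by have := path_a0 Hp; have := path_d1 Hp 0%N; lra. Qed.

Lemma path_step1 i : y1 i <= y1 i.+1.
Proof.
rewrite (path_y1 Hp) lerDl; apply: mulr_ge0; first exact: ler0n.
by have := path_a0 Hp; have := path_d1 Hp i; lra.
Qed.

Lemma path_step2 i : y2 i <= y2 i.+1.
Proof.
rewrite (path_y2 Hp) lerDl; apply: mulr_ge0; first exact: ler0n.
by have := path_a0 Hp; have := path_d2 Hp i; lra.
Qed.

Lemma path_mono1 i k : y1 i <= y1 (i + k)%N.
Proof.
elim: k => [|k IH]; first by rewrite addn0.
by rewrite addnS (le_trans IH)// path_step1.
Qed.

Lemma path_mono2 i k : y2 i <= y2 (i + k)%N.
Proof.
elim: k => [|k IH]; first by rewrite addn0.
by rewrite addnS (le_trans IH)// path_step2.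
Qed.

Lemma path_growth i k : y (i + k)%N <= y i + b * k%:R.
Proof.
elim: k => [|k IH]; first by rewrite addn0 mulr0 addr0.
rewrite addnS (path_y1 Hp) (path_y2 Hp) -natr1 mulrDr mulr1.
have := path_d1 Hp (i + k)%N; have := path_d2 Hp (i + k)%N; have := path_a0 Hp.
case: (x _); case: (w1 _); case: (w2 _) => /=;
  rewrite ?mul1r ?mul0r => *; lra.
Qed.

Lemma path_y1_gt0 i : 0 < y1 i.
Proof. by apply: lt_le_trans (path_mono1 0 i); exact: path_y10 Hp. Qed.

Lemma path_y2_gt0 i : 0 < y2 i.
Proof. by apply: lt_le_trans (path_mono2 0 i); exact: path_y20 Hp. Qed.

Lemma path_y_gt0 i : 0 < y i.
Proof. by rewrite addr_gt0// ?path_y1_gt0 ?path_y2_gt0. Qed.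

Lemma frac_gt0 i : 0 < z i.
Proof. by rewrite /frac divr_gt0 ?path_y1_gt0 ?path_y_gt0. Qed.

Lemma frac_swap i : frac y2 y1 i = 1 - z i.
Proof.
have y0 : y i != 0 by rewrite gt_eqF// path_y_gt0.
by rewrite /frac [y2 i + _]addrC; field.
Qed.

Lemma frac_lt1 i : z i < 1.
Proof.
rewrite /frac ltr_pdivrMr ?path_y_gt0// mul1r ltrDl; exact: path_y2_gt0.
Qed.

(** The weights are frozen at time [s]; only the denominator is taken at time [t]. A drift over a
    block thus reduces to estimates of the two increments. *)
Lemma frac_diff s t : z t - z s =
  ((1 - z s) * (y1 t - y1 s) - z s * (y2 t - y2 s)) / y t.
Proof.
have yt : y t != 0 by rewrite gt_eqF// path_y_gt0.
have ys : y s != 0 by rewrite gt_eqF// path_y_gt0.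
by rewrite /frac; field; rewrite yt ys.
Qed.

(** In [frac_diff] the two increments carry weights in [0, 1] with opposite signs, so the numerator
    is at most the growth of the total, and the total never decreases. *)
Lemma frac_osc s k : `|z (s + k)%N - z s| <= b * k%:R / y s.
Proof.
have b0 := path_b_gt0; have ys := path_y_gt0 s.
have yt := path_y_gt0 (s + k).
rewrite frac_diff normrM normfV (gtr0_norm yt).
have M1 := path_mono1 s k; have M2 := path_mono2 s k.
have G := path_growth s k.
have z0 := frac_gt0 s; have z1 := frac_lt1 s.
apply: ler_pM => //.
- by rewrite invr_ge0 ltW.
- rewrite ler_norml; apply/andP; split; nra.
- by rewrite lef_pV2 ?posrE//; lra.
Qed.

(* Below level r no white ball is added; above it, one white ball multiplies
   the fraction by at least y / (y + b). *)
Lemma frac_lower N r :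
  0 < r -> (forall i, (N <= i)%N -> z i < r -> ~~ w2 i) ->
  forall i, (N <= i)%N ->
  Num.min (y1 0%N / (y 0%N + b * N%:R)) (r * (y 0%N / (y 0%N + b))) <= z i.
Proof.
move=> r0 Hr i Ni; set q := Num.min _ _.
have b0 := path_b_gt0.
have Y0 := path_y_gt0 0.
rewrite -(subnKC Ni); elim: (i - N)%N => [|k IH].
  (* At time [N] itself: [y1] has not decreased since time 0, and the total has gained at most
     [b * N]. *)
  rewrite addn0 /q ge_min; apply/orP; left; rewrite /frac.
  apply: ler_pM => //; first exact/ltW/path_y10/Hp.
  - by rewrite invr_ge0; have := ler0n R N; nra.
  - by have := path_mono1 0 N.
  - rewrite lef_pV2 ?posrE ?path_y_gt0//; last by have := ler0n R N; nra.
    by have := path_growth 0 N.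
rewrite addnS; set j := (N + k)%N in IH *.
have yj := path_y_gt0 j; have yj1 := path_y_gt0 j.+1.
have D1 := path_d1 Hp j; have D2 := path_d2 Hp j; have a0 := path_a0 Hp.
have y1j := path_y1_gt0 j; have y2j := path_y2_gt0 j.
case: (boolP (~~ x j && w2 j)) => xw; last first.
  apply: le_trans IH _; rewrite /frac ler_pdivrMr// mulrAC ler_pdivlMr//.
  have e2 : y2 j.+1 = y2 j by rewrite (path_y2 Hp) (negbTE xw) mul0r addr0.
  by rewrite e2; have := path_step1 j; nra.
have rz : r <= z j.
  by rewrite leNgt; apply/negP => /(Hr _ (leq_addr _ _)); case/andP: xw => _ ->.
have e1 : y1 j.+1 = y1 j.
  by rewrite (path_y1 Hp); case/andP: xw => /negbTE -> _; rewrite mul0r addr0.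
have e2 : y2 j.+1 = y2 j + d2 j by rewrite (path_y2 Hp) xw mul1r.
have Ym : y 0%N <= y j.
  by have := path_mono1 0 j; have := path_mono2 0 j; rewrite !add0n; lra.
have -> : z j.+1 = z j * (y j / (y j + d2 j)).
  rewrite /frac e1 e2; field; apply/andP; split; rewrite gt_eqF//; lra.
rewrite /q ge_min; apply/orP; right.
apply: ler_pM => //; first exact: ltW.
  by rewrite divr_ge0//; lra.
rewrite ler_pdivrMr; last by lra.
rewrite mulrAC ler_pdivlMr; last by lra.
nra.
Qed.

Lemma path_compensator n :
  y1 n = y1 0%N + \sum_(0 <= i < n) z i * d1 i * (w1 i)%:R
         + noise y1 y2 d1 x w1 n.
Proof.
elim: n => [|n IH]; first by rewrite /noise !big_geq// !addr0.
rewrite (path_y1 Hp) {1}IH /noise !big_nat_recr//=.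
by case: (x n); case: (w1 n) => /=; ring.
Qed.

End path_theory.

Lemma sum_block (V : zmodType) (F : nat -> V) s h :
  \sum_(s <= i < s + h) F i =
  \sum_(0 <= i < s + h) F i - \sum_(0 <= i < s) F i.
Proof. by rewrite (@big_cat_nat _ _ _ s 0)//= ?leq_addr// addrAC subrr add0r. Qed.

(** Serves to replace the fraction inside a block by its value at the start of the block, at a cost
    of [s * b] per step. *)
Lemma mul_osc_le (R : realFieldType) (u v d s b : R) :
  0 <= d -> d <= b -> 0 <= s -> v - u <= s -> v * d <= u * d + s * b.
Proof.
move=> d0 db s0 vu; have H1 : (v - u) * d <= s * d by rewrite ler_wpM2r.
have H2 : s * d <= s * b by rewrite ler_wpM2l.
by rewrite mulrBl in H1; lra.
Qed.

(** * Sequences with a drift of harmonic size towards a target *)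

Section harmonic_drift.
Variables (R : realFieldType) (A : nat -> R) (rho e r : R) (j0 K : nat).
Hypothesis r0 : 0 <= r.
Hypothesis Hosc : forall j, (j0 <= j < K)%N -> `|A j.+1 - A j| <= e.
Hypothesis Hup : forall j, (j0 <= j < K)%N -> A j < rho - 2 * e ->
  A j + r / j.+1%:R <= A j.+1.

(** Below [rho - 2 * e] each step gains [r / j.+1]; from above that level a single step loses at
    most [e], hence cannot fall below [rho - 3 * e]. *)
Lemma drift_lower j : (j0 <= j <= K)%N ->
  Num.min (rho - 3 * e) (A j0 + r * \sum_(j0 <= i < j) i.+1%:R^-1) <= A j.
Proof.
case/andP => jj; rewrite -(subnKC jj); elim: (j - j0)%N => [_|k IH].
  by rewrite addn0 big_geq// mulr0 addr0 ge_min lexx orbT.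
rewrite addnS => Hk; have {}IH := IH (ltnW Hk).
set i := (j0 + k)%N in IH Hk *.
have Hi : (j0 <= i < K)%N by rewrite leq_addr.
have := Hosc Hi; rewrite ler_norml => /andP[osc1 _].
have [lt|ge] := ltP (A i) (rho - 2 * e); last first.
  by rewrite ge_min; apply/orP; left; lra.
have U := Hup Hi lt.
have ri : 0 <= r / i.+1%:R by rewrite mulr_ge0// invr_ge0.
rewrite big_nat_recr ?leq_addr//= mulrDr addrA.
move: U ri IH; rewrite !ge_min; move: (r / i.+1%:R) => q U q0.
by move=> /orP[] ?; apply/orP; [left|right]; lra.
Qed.

End harmonic_drift.

(** [drift_lower] is applied to [A] and to [- A]. As [A] stays in (0, 1), an accumulated drift of at
    least 1 excludes the second term of either minimum. *)
Lemma drift_target (R : realFieldType) (A : nat -> R) (rho e r : R) j0 K :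
  0 <= r -> (j0 <= K)%N ->
  (forall j, 0 < A j < 1) ->
  (forall j, (j0 <= j < K)%N -> `|A j.+1 - A j| <= e) ->
  (forall j, (j0 <= j < K)%N -> A j < rho - 2 * e ->
     A j + r / j.+1%:R <= A j.+1) ->
  (forall j, (j0 <= j < K)%N -> rho + 2 * e < A j ->
     A j.+1 <= A j - r / j.+1%:R) ->
  1 <= r * \sum_(j0 <= i < K) i.+1%:R^-1 ->
  `|A K - rho| <= 3 * e.
Proof.
move=> r0 jK A01 Hosc Hup Hdown H1.
have jKK : (j0 <= K <= K)%N by rewrite jK leqnn.
have L := drift_lower r0 Hosc Hup jKK.
have Hosc' j : (j0 <= j < K)%N -> `|- A j.+1 - - A j| <= e.
  by move=> /Hosc; rewrite -opprD normrN.
have Hdown' j : (j0 <= j < K)%N -> - A j < - rho - 2 * e ->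
    - A j + r / j.+1%:R <= - A j.+1.
  move=> jj lt; have lt' : rho + 2 * e < A j by lra.
  by have := Hdown j jj lt'; move: (r / _) => q; lra.
have L' := @drift_lower _ (fun j => - A j) _ _ _ _ _ r0 Hosc' Hdown' _ jKK.
have /andP[? ?] := A01 j0; have /andP[? ?] := A01 K.
move: L L' H1; rewrite !ge_min ler_norml /=; move: (r * _) => q.
by case/orP => ?; case/orP => ? ?; apply/andP; split; lra.
Qed.

(* N: time from which the thresholds are regular; h, K: length and number of
   blocks; th: relative size of the errors on a block; bad i: a threshold is not
   e-close to its limit at time i. *)
Record good_scale (R : realFieldType) (y1 y2 d1 d2 : nat -> R)
    (x w1 w2 bad : nat -> bool) (N h K : nat) (p e th rho m1 m2 : R) : Prop :=
  GoodScale {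
  gs_frac : forall i, (N <= i)%N -> p <= frac y1 y2 i <= 1 - p;
  gs_w : forall i, (N <= i)%N -> w1 i || w2 i;
  gs_noise1 : forall j, (j <= K)%N ->
    `|noise y1 y2 d1 x w1 (j * h)| <= th * h%:R;
  gs_noise2 : forall j, (j <= K)%N ->
    `|noise y2 y1 d2 (fun i => ~~ x i) w2 (j * h)| <= th * h%:R;
  gs_mean1 : forall j, (j <= K)%N ->
    `|\sum_(0 <= i < j * h) d1 i - m1 * (j * h)%:R| <= th * h%:R;
  gs_mean2 : forall j, (j <= K)%N ->
    `|\sum_(0 <= i < j * h) d2 i - m2 * (j * h)%:R| <= th * h%:R;
  gs_bad : \sum_(0 <= i < K * h) (bad i)%:R <= th * h%:R;
  gs_low : forall i, ~~ bad i -> frac y1 y2 i < rho - e -> w1 i;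
  gs_high : forall i, ~~ bad i -> rho + e < frac y1 y2 i -> ~~ w1 i && w2 i }.

(** * Growth and drift over blocks along a good path *)

Section good_scale_theory.
Variables (R : realFieldType) (a b : R) (y1 y2 d1 d2 : nat -> R).
Variables (x w1 w2 bad : nat -> bool).
Hypothesis Hp : urn_path a b y1 y2 d1 d2 x w1 w2.
Variables (N h K j0 : nat) (p e th rho m1 m2 g sg : R).
Hypothesis Hg : good_scale y1 y2 d1 d2 x w1 w2 bad N h K p e th rho m1 m2.
Hypothesis p0 : 0 < p.
Hypothesis th0 : 0 <= th.
Hypothesis th_small : th <= a * p / 8.
Hypothesis hN : (4 * N < h)%N.
Hypothesis j0_gt0 : (0 < j0)%N.

Local Notation z := (frac y1 y2).
Local Notation y i := (y1 i + y2 i).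
Local Notation c := (a * p / 2).

(** From time [N] on at least one colour is replenished and both fractions are at least [p], so each
    summand is at least [a * p]; earlier summands are nonnegative. *)
Lemma compensator_growth n :
  a * p * (n%:R - N%:R) <=
  \sum_(0 <= i < n) (z i * d1 i * (w1 i)%:R + (1 - z i) * d2 i * (w2 i)%:R).
Proof.
have a0 := path_a0 Hp.
elim: n => [|n IH].
  by rewrite big_geq// sub0r mulrN oppr_le0 !mulr_ge0// ltW.
rewrite big_nat_recr//=.
have D1 := path_d1 Hp n; have D2 := path_d2 Hp n.
have z0 := frac_gt0 Hp n; have z1 := frac_lt1 Hp n.
have [nN|Nn] := ltnP n N.
  apply: (@le_trans _ _ 0).
    rewrite mulr_ge0_le0// ?subr_le0 ?ler_nat//; first by rewrite mulr_ge0// ltW.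
  have F0 i : 0 <= z i * d1 i * (w1 i)%:R + (1 - z i) * d2 i * (w2 i)%:R.
    have D1i := path_d1 Hp i; have D2i := path_d2 Hp i.
    have z0i := frac_gt0 Hp i; have z1i := frac_lt1 Hp i.
    by apply: addr_ge0; apply: mulr_ge0 => //; apply: mulr_ge0; lra.
  by apply: addr_ge0 => //; apply: sumr_ge0.
have := gs_w Hg Nn; have := gs_frac Hg Nn.
rewrite -natr1 => zp ww.
suff : a * p <= z n * d1 n * (w1 n)%:R + (1 - z n) * d2 n * (w2 n)%:R by lra.
by case: (w1 n) ww; case: (w2 n) => //= _; nra.
Qed.

(** Of the slope [a * p], the two noises use at most a quarter by [th_small] and the first [N] steps
    another quarter by [hN]; half of it, [c], remains. *)
Lemma linear_growth j : (0 < j <= K)%N -> c * (j * h)%:R <= y (j * h)%N.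
Proof.
case/andP=> j1 jK; have a0 := path_a0 Hp.
have C1 := path_compensator Hp (j * h).
have C2 := path_compensator (urn_path_swap Hp) (j * h).
have G := compensator_growth (j * h).
have := gs_noise1 Hg jK; have := gs_noise2 Hg jK.
rewrite !ler_norml => /andP[n2 _] /andP[n1 _].
move: G; rewrite big_split/=.
under [X in _ <= _ + X -> _]eq_bigr do rewrite -(frac_swap Hp).
have y10 := path_y10 Hp; have y20 := path_y20 Hp.
move=> G; rewrite C1 C2.
have hh : h%:R <= (j * h)%:R :> R by rewrite ler_nat leq_pmull.
have NN : 4 * N%:R <= h%:R :> R by rewrite -natrM ler_nat ltnW.
have ap : 0 < a * p by rewrite mulr_gt0.
have h0 : 0 <= h%:R :> R by [].
have T : th * h%:R <= a * p / 8 * h%:R by rewrite ler_wpM2r.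
suff : c * (j * h)%:R <= a * p * ((j * h)%:R - N%:R) - 2 * (th * h%:R) by lra.
have : a * p * (4 * N%:R) <= a * p * h%:R by rewrite ler_pM2l.
have : a * p * h%:R <= a * p * (j * h)%:R by rewrite ler_pM2l.
lra.
Qed.

Hypothesis sg0 : 0 <= sg.
Hypothesis sg_e : sg <= e.
Hypothesis j0_large : b <= sg * (c * j0%:R).

Section block.
Variable j : nat.
Hypothesis Hj : (j0 <= j < K)%N.
Let s := (j * h)%N.

Let h_gt0 : (0 < h)%N. Proof. exact: leq_ltn_trans hN. Qed.

Let Ns : (N <= s)%N.
Proof.
rewrite /s; case/andP: Hj => j0j _.
have : (1 <= j)%N by exact: leq_trans j0j.
by have := hN; nia.
Qed.

(** A block adds at most [b * h] to a total of at least [c * j0 * h]; [j0_large] bounds the ratio by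
    [sg]. *)
Let block_osc k : (k <= h)%N -> `|z (s + k)%N - z s| <= sg.
Proof.
move=> kh; apply: le_trans (frac_osc Hp s k) _.
rewrite ler_pdivrMr ?(path_y_gt0 Hp)//.
have b0 := path_b_gt0 Hp; have a0 := path_a0 Hp.
have jj : (0 < j <= K)%N by case/andP: Hj => u /ltnW ->; rewrite (leq_trans _ u).
have G := linear_growth jj.
have kh' : k%:R <= h%:R :> R by rewrite ler_nat.
apply: (@le_trans _ _ (sg * (c * (j * h)%:R))); last by rewrite ler_wpM2l.
apply: (@le_trans _ _ (b * h%:R)); first by rewrite ler_pM2l.
rewrite natrM !mulrA ler_wpM2r//; apply: le_trans j0_large _.
rewrite !mulrA ler_wpM2l//.
  by rewrite divr_ge0// mulr_ge0// ?mulr_ge0// ltW.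
by rewrite ler_nat; case/andP: Hj.
Qed.

Let block_osc_in i : (s <= i < s + h)%N -> `|z i - z s| <= sg.
Proof.
case/andP=> si ih; rewrite -(subnKC si); apply: block_osc.
by rewrite leq_subLR ltnW.
Qed.

Let sh : (s + h = j.+1 * h)%N. Proof. by rewrite mulSn addnC. Qed.
Let jK : (j <= K)%N. Proof. by case/andP: Hj => _ /ltnW. Qed.
Let jK1 : (j.+1 <= K)%N. Proof. by case/andP: Hj. Qed.

(** A block sum is the difference of two initial sums, each with error [th * h], whence the factor
    2. The noises in [block_y1] and [block_y2] are treated alike. *)
Let block_mean (d : nat -> R) m :
  (forall j, (j <= K)%N ->
    `|\sum_(0 <= i < j * h) d i - m * (j * h)%:R| <= th * h%:R) ->
  `|\sum_(s <= i < s + h) d i - m * h%:R| <= 2 * (th * h%:R).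
Proof.
move=> Hd; rewrite (sum_block _ s h).
have := Hd _ jK; have := Hd _ jK1; rewrite -sh -/s natrD !ler_norml.
by move=> /andP[? ?] /andP[? ?]; apply/andP; split; lra.
Qed.

Let block_bad : \sum_(s <= i < s + h) (bad i)%:R <= th * h%:R.
Proof.
apply: le_trans _ (gs_bad Hg); rewrite (sum_block _ s h) sh.
rewrite [leRHS](@big_cat_nat _ _ _ (j.+1 * h))//=; last first.
  by rewrite leq_mul2r jK1 orbT.
rewrite lerD2l (@le_trans _ _ 0)// ?oppr_le0 sumr_ge0//.
Qed.

Let block_y1 : `|(y1 (s + h)%N - y1 s)
  - \sum_(s <= i < s + h) z i * d1 i * (w1 i)%:R| <= 2 * (th * h%:R).
Proof.
rewrite (path_compensator Hp (s + h)) (path_compensator Hp s) (sum_block _ s h).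
have := gs_noise1 Hg jK; have := gs_noise1 Hg jK1; rewrite -sh -/s !ler_norml.
by move=> /andP[? ?] /andP[? ?]; apply/andP; split; lra.
Qed.

Let block_y2 : `|(y2 (s + h)%N - y2 s)
  - \sum_(s <= i < s + h) (1 - z i) * d2 i * (w2 i)%:R| <= 2 * (th * h%:R).
Proof.
under eq_bigr do rewrite -(frac_swap Hp).
rewrite (path_compensator (urn_path_swap Hp) (s + h)).
rewrite (path_compensator (urn_path_swap Hp) s) (sum_block _ s h).
have := gs_noise2 Hg jK; have := gs_noise2 Hg jK1; rewrite -sh -/s !ler_norml.
by move=> /andP[? ?] /andP[? ?]; apply/andP; split; lra.
Qed.

(** Below the target red is replenished at every good time, so [y1] gains about [z s * m1 * h]; [y2]
    gains at most about [(1 - z s) * m2 * h], whether or not white is replenished. The weighted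
    difference is [z s * (1 - z s) * (m1 - m2) * h]. Noise and means cost 4 [th] per colour, the
    oscillation of the fraction [sg * b] per colour, and the bad times [b * th]. *)
Lemma block_up : z s < rho - 2 * e ->
  g + 8 * th + 2 * (sg * b) + b * th <= p ^+ 2 * (m1 - m2) ->
  m2 < m1 ->
  g * h%:R <= (1 - z s) * (y1 (s + h)%N - y1 s) - z s * (y2 (s + h)%N - y2 s).
Proof.
move=> zs Hgg m12.
have a0 := path_a0 Hp; have b0 := path_b_gt0 Hp; have p_gt0 := p0.
have th_ge0 := th0; have sg_ge0 := sg0; have sg_le := sg_e.
have z0 := frac_gt0 Hp s; have z1 := frac_lt1 Hp s.
have zp := gs_frac Hg Ns.
have h0 : 0 <= h%:R :> R by [].
have C1 : z s * (\sum_(s <= i < s + h) d1 i) - sg * b * h%:R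
          - b * (\sum_(s <= i < s + h) (bad i)%:R)
    <= \sum_(s <= i < s + h) z i * d1 i * (w1 i)%:R.
  have -> : sg * b * h%:R = \sum_(s <= i < s + h) sg * b.
    by rewrite sumr_const_nat addKn mulr_natr.
  rewrite !mulr_sumr -!sumrB; apply: ler_sum_nat => i Hi.
  have := block_osc_in Hi; rewrite ler_norml => /andP[lo hi].
  have D1 := path_d1 Hp i.
  (* At a bad time the summand is only known to be nonnegative; the subtracted [b] absorbs the
     missing amount. *)
  have [bi|nb] := boolP (bad i).
    have zi0 := frac_gt0 Hp i; apply: (@le_trans _ _ 0); last first.
      by apply: mulr_ge0 => //; apply: mulr_ge0; lra.
    rewrite mulr1; have : z s * d1 i <= d1 i by rewrite ler_piMl; lra.
    have : 0 <= sg * b by rewrite mulr_ge0// ltW.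
    lra.
  have -> : w1 i by apply: (gs_low Hg nb); lra.
  rewrite mulr0 mulr1 subr0.
  rewrite lerBlDr; apply: mul_osc_le; lra.
have C2 : \sum_(s <= i < s + h) (1 - z i) * d2 i * (w2 i)%:R <=
    (1 - z s) * (\sum_(s <= i < s + h) d2 i) + sg * b * h%:R.
  have -> : sg * b * h%:R = \sum_(s <= i < s + h) sg * b.
    by rewrite sumr_const_nat addKn mulr_natr.
  rewrite !mulr_sumr -!big_split/=; apply: ler_sum_nat => i Hi.
  have := block_osc_in Hi; rewrite ler_norml => /andP[lo hi].
  have D2 := path_d2 Hp i; have zi1 := frac_lt1 Hp i.
  case: (w2 i); first by rewrite mulr1; apply: mul_osc_le; lra.
  by rewrite mulr0 addr_ge0// mulr_ge0//; lra.
have M1 := block_mean (gs_mean1 Hg); have M2 := block_mean (gs_mean2 Hg).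
have B := block_bad.
move: M1 M2 block_y1 block_y2; rewrite !ler_norml.
move=> /andP[M1 _] /andP[_ M2] /andP[Y1 _] /andP[_ Y2].
set D1 := \sum_(s <= i < s + h) d1 i in C1 M1.
set D2 := \sum_(s <= i < s + h) d2 i in C2 M2.
set B1 := \sum_(s <= i < s + h) (bad i)%:R in C1 B.
set t := th * h%:R in M1 M2 Y1 Y2 B.
have t0 : 0 <= t by rewrite mulr_ge0.
have E1 : z s * (m1 * h%:R) - 4 * t - sg * b * h%:R - b * t
    <= y1 (s + h)%N - y1 s.
  have : z s * (m1 * h%:R - 2 * t) <= z s * D1 by rewrite ler_pM2l//; lra.
  have : b * B1 <= b * t by rewrite ler_pM2l.
  have : z s * t <= t by rewrite ler_piMl// ltW.
  by lra.
have E2 : y2 (s + h)%N - y2 s <=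
    (1 - z s) * (m2 * h%:R) + 4 * t + sg * b * h%:R.
  have : (1 - z s) * D2 <= (1 - z s) * (m2 * h%:R + 2 * t).
    by rewrite ler_wpM2l//; lra.
  have : (1 - z s) * t <= t by rewrite ler_piMl//; lra.
  by lra.
set Sb := sg * b * h%:R in E1 E2.
have Sb0 : 0 <= Sb by rewrite !mulr_ge0// ltW.
have bt0 : 0 <= b * t by rewrite mulr_ge0// ltW.
have F1 : (1 - z s) * (z s * (m1 * h%:R)) - (4 * t + Sb + b * t) <=
    (1 - z s) * (y1 (s + h)%N - y1 s).
  apply: (@le_trans _ _ ((1 - z s) * (z s * (m1 * h%:R) - 4 * t - Sb - b * t))).
    have : (1 - z s) * (4 * t + Sb + b * t) <= 4 * t + Sb + b * t.
      by rewrite ler_piMl//; lra.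
    by lra.
  by rewrite ler_wpM2l//; lra.
have F2 : z s * (y2 (s + h)%N - y2 s) <=
    z s * ((1 - z s) * (m2 * h%:R)) + (4 * t + Sb).
  apply: (@le_trans _ _ (z s * ((1 - z s) * (m2 * h%:R) + 4 * t + Sb))).
    by rewrite ler_wpM2l// ltW.
  have : z s * (4 * t + Sb) <= 4 * t + Sb by rewrite ler_piMl//; lra.
  by lra.
have P2 : p ^+ 2 <= z s * (1 - z s) by rewrite expr2; apply: ler_pM; lra.
have P3 : p ^+ 2 * ((m1 - m2) * h%:R) <= z s * (1 - z s) * ((m1 - m2) * h%:R).
  by rewrite ler_wpM2r// mulr_ge0//; lra.
have P4 : (g + 8 * th + 2 * (sg * b) + b * th) * h%:R <=
    p ^+ 2 * (m1 - m2) * h%:R by rewrite ler_wpM2r.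
rewrite /Sb /t in F1 F2.
lra.
Qed.

(** Above the target red is replenished at bad times only, and white at all good times. The factor
    [p ^+ 2] comes once from the white fraction in the compensator and once from the weight
    [z s]. *)
Lemma block_down : rho + 2 * e < z s ->
  g + (2 * b + 4) * th <= p ^+ 2 * a ->
  (1 - z s) * (y1 (s + h)%N - y1 s) - z s * (y2 (s + h)%N - y2 s) <= - (g * h%:R).
Proof.
move=> zs Hgg.
have a0 := path_a0 Hp; have b0 := path_b_gt0 Hp.
have th_ge0 := th0; have sg_ge0 := sg0; have sg_le := sg_e.
have p_gt0 := p0; have ab : a <= b by have := path_d1 Hp 0%N; lra.
have z0 := frac_gt0 Hp s; have z1 := frac_lt1 Hp s.
have zp := gs_frac Hg Ns.
have h0 : 0 <= h%:R :> R by [].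
have C1 : \sum_(s <= i < s + h) z i * d1 i * (w1 i)%:R <=
    b * (\sum_(s <= i < s + h) (bad i)%:R).
  rewrite mulr_sumr; apply: ler_sum_nat => i Hi.
  have := block_osc_in Hi; rewrite ler_norml => /andP[lo hi].
  have D1 := path_d1 Hp i; have zi0 := frac_gt0 Hp i; have zi1 := frac_lt1 Hp i.
  have [bi|nb] := boolP (bad i).
    have : z i * d1 i <= d1 i by rewrite ler_piMl; lra.
    by case: (w1 i); rewrite ?mulr1 ?mulr0; lra.
  have /andP[/negbTE -> _] : ~~ w1 i && w2 i by apply: (gs_high Hg) => //; lra.
  by rewrite !mulr0.
have C2 : p * a * h%:R - p * a * (\sum_(s <= i < s + h) (bad i)%:R) <=
    \sum_(s <= i < s + h) (1 - z i) * d2 i * (w2 i)%:R.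
  have -> : p * a * h%:R = \sum_(s <= i < s + h) p * a.
    by rewrite sumr_const_nat addKn mulr_natr.
  rewrite mulr_sumr -sumrB; apply: ler_sum_nat => i Hi.
  have := block_osc_in Hi; rewrite ler_norml => /andP[lo hi].
  have D2 := path_d2 Hp i; have zi0 := frac_gt0 Hp i; have zi1 := frac_lt1 Hp i.
  have zip : p <= z i <= 1 - p.
    by apply: (gs_frac Hg); case/andP: Hi => + _; exact: leq_trans.
  have [bi|nb] := boolP (bad i).
    rewrite mulr1 subrr; apply: mulr_ge0 => //; apply: mulr_ge0; lra.
  have /andP[_ ->] : ~~ w1 i && w2 i by apply: (gs_high Hg) => //; lra.
  rewrite mulr0 mulr1 subr0; apply: ler_pM; lra.
have B := block_bad.
move: block_y1 block_y2; rewrite !ler_norml => /andP[_ Y1] /andP[Y2 _].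
set B1 := \sum_(s <= i < s + h) (bad i)%:R in C1 C2 B.
set t := th * h%:R in Y1 Y2 B.
have t0 : 0 <= t by rewrite mulr_ge0.
have pa : 0 < p * a by rewrite mulr_gt0.
have bt0 : 0 <= b * t by rewrite mulr_ge0// ltW.
have F1 : (1 - z s) * (y1 (s + h)%N - y1 s) <= b * t + 2 * t.
  have bB : b * B1 <= b * t by rewrite ler_pM2l.
  have : (1 - z s) * (y1 (s + h)%N - y1 s) <= (1 - z s) * (b * t + 2 * t).
    by rewrite ler_wpM2l//; lra.
  have : (1 - z s) * (b * t + 2 * t) <= b * t + 2 * t by rewrite ler_piMl//; lra.
  lra.
have F2 : p * (p * a * h%:R) - (a * t + 2 * t) <= z s * (y2 (s + h)%N - y2 s).
  (* The lower bound on the increment may be negative, so the weight [z s] is first lowered to [p]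
     on the increment itself, which is nonnegative. *)
  have Z0 : 0 <= y2 (s + h)%N - y2 s by rewrite subr_ge0 (path_mono2 Hp).
  have : p * (y2 (s + h)%N - y2 s) <= z s * (y2 (s + h)%N - y2 s).
    by rewrite ler_wpM2r//; lra.
  have pB : p * a * B1 <= p * a * t by rewrite ler_pM2l.
  have : p * (p * a * h%:R - p * a * t - 2 * t) <= p * (y2 (s + h)%N - y2 s).
    by rewrite ler_pM2l//; lra.
  have pt : p * t <= t by rewrite ler_piMl//; lra.
  have : p * (p * (a * t)) <= p * (a * t).
    by rewrite ler_piMl ?mulr_ge0//; lra.
  have : p * (a * t) <= a * t.
    by rewrite ler_piMl ?mulr_ge0//; lra.
  lra.
have P4 : (g + (2 * b + 4) * th) * h%:R <= p ^+ 2 * a * h%:R by rewrite ler_wpM2r.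
have : a * t <= b * t by rewrite ler_wpM2r.
rewrite /t expr2 in F1 F2 P4 *.
lra.
Qed.

Lemma block_frac_osc : `|z (j.+1 * h)%N - z (j * h)%N| <= e.
Proof. by rewrite -sh; apply: le_trans (block_osc (leqnn h)) _. Qed.

Lemma block_denominator : y 0%N <= b * h%:R ->
  y (j.+1 * h)%N <= 2 * b * (j.+1%:R * h%:R).
Proof.
move=> y0; have := path_growth Hp 0 (j.+1 * h)%N; rewrite add0n natrM.
have b0 := path_b_gt0 Hp.
have h0 : 0 <= h%:R :> R by [].
have : h%:R <= j.+1%:R * h%:R :> R by rewrite ler_peMl// ler1n.
by nra.
Qed.

End block.

(** At the block ends [drift_target] applies with [r = g / (2 * b)]: a gain of [g * h] is divided by
    a total of at most [2 * b * j.+1 * h]. This gives [3 * e] at time [K * h]; the fewer than [K]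
    remaining steps account for the last [e]. *)
Theorem frac_near_target n :
  m2 < m1 -> 0 <= g ->
  g + 8 * th + 2 * (sg * b) + b * th <= p ^+ 2 * (m1 - m2) ->
  g + (2 * b + 4) * th <= p ^+ 2 * a ->
  y 0%N <= b * h%:R ->
  (j0 <= K)%N -> 1 <= g / (2 * b) * \sum_(j0 <= i < K) i.+1%:R^-1 ->
  b <= e * (c * h%:R) -> (K * h <= n < K * h + K)%N ->
  `|z n - rho| <= 4 * e.
Proof.
move=> m12 g0 Hg1 Hg2 y0 jK Hsum he Hn.
have a0 := path_a0 Hp; have b0 := path_b_gt0 Hp.
have h0 : 0 < h%:R :> R by rewrite ltr0n (leq_ltn_trans _ hN).
have p_gt0 := p0; have th_ge0 := th0; have sg_ge0 := sg0; have sg_le := sg_e.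
have frac_step j (D : R) : (j0 <= j < K)%N -> g * h%:R <= D ->
    g / (2 * b) / j.+1%:R <= D / y (j.+1 * h)%N.
  move=> Hj gD; have yt := path_y_gt0 Hp (j.+1 * h)%N.
  rewrite ler_pdivlMr//; apply: le_trans gD.
  have -> : g * h%:R = g / (2 * b) / j.+1%:R * (2 * b * (j.+1%:R * h%:R)).
    by field; rewrite addrC natr1 pnatr_eq0 /= gt_eqF.
  rewrite ler_wpM2l//; first by rewrite !divr_ge0// mulr_ge0// ltW.
  exact: block_denominator.
have HK : `|z (K * h)%N - rho| <= 3 * e.
  apply: (@drift_target _ (fun j => z (j * h)%N) _ _ (g / (2 * b)) j0) => //.
  - by rewrite divr_ge0// mulr_ge0// ltW.
  - by move=> j; rewrite (frac_gt0 Hp) (frac_lt1 Hp).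
  - by move=> j Hj; exact: block_frac_osc.
  - move=> j Hj lt; have := block_up Hj lt Hg1 m12.
    rewrite addnC -mulSn => /(frac_step _ _ Hj).
    by rewrite -(frac_diff Hp) /=; move: (g / _ / _) => q; lra.
  - move=> j Hj lt; have := block_down Hj lt Hg2.
    rewrite addnC -mulSn lerNr => /(frac_step _ _ Hj).
    by rewrite mulNr -(frac_diff Hp) /=; move: (g / _ / _) => q; lra.
case/andP: Hn => n1 n2; rewrite -(subnKC n1).
set k := (n - K * h)%N.
have kK : (k <= K)%N by rewrite leq_subLR ltnW.
have K0 : (0 < K)%N by exact: leq_trans jK.
(* At most [K] steps add at most [b * K] to a total of at least [c * K * h], so [h] alone makes the
   ratio small. *)
have osc : `|z (K * h + k)%N - z (K * h)%N| <= e.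
  apply: le_trans (frac_osc Hp _ _) _.
  rewrite ler_pdivrMr ?(path_y_gt0 Hp)//.
  have G : c * (K * h)%:R <= y (K * h)%N by apply: linear_growth; rewrite K0 leqnn.
  have e0 : 0 <= e by exact: le_trans sg_e.
  apply: le_trans (ler_wpM2l e0 G).
  apply: (@le_trans _ _ (b * K%:R)); first by rewrite ler_pM2l// ler_nat.
  rewrite natrM [K%:R * _]mulrC !mulrA ler_wpM2r//.
  by move: he; rewrite !mulrA.
have := ler_normD (z (K * h + k)%N - z (K * h)%N) (z (K * h)%N - rho).
move: (lerD osc HK).
by rewrite subrKA; lra.
Qed.

End good_scale_theory.

(** A bounded tail would make the partial sums nondecreasing and bounded, and the harmonic series
    convergent. *)
Lemma harmonic_tail_unbounded (R : realType) (j0 : nat) (M : R) :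
  exists2 K, (j0 <= K)%N & M <= \sum_(j0 <= i < K) i.+1%:R^-1.
Proof.
apply: contrapT => H; apply: (@dvg_harmonic R).
have term0 i : 0 <= i.+1%:R^-1 :> R by rewrite invr_ge0.
apply: nondecreasing_is_cvgn.
  apply/nondecreasing_seqP => n; rewrite /series/= big_nat_recr//= lerDl.
  exact: term0.
exists (\sum_(0 <= i < j0) i.+1%:R^-1 + `|M|) => _ [n _ <-].
have [nj|jn] := leqP n j0.
  apply: (@le_trans _ _ (\sum_(0 <= i < j0) i.+1%:R^-1)); last by rewrite lerDl.
  rewrite /series/= [leRHS](@big_cat_nat _ _ _ n)//= lerDl.
  by apply: sumr_ge0 => i _; apply: term0.
rewrite /series/= (@big_cat_nat _ _ _ j0)//= ?(ltnW jn)// lerD2l.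
rewrite leNgt; apply/negP => Mn; apply: H; exists n; first exact: ltnW.
exact: le_trans (ler_norm M) (ltW Mn).
Qed.

Lemma archi_nat (R : realType) (c M : R) : 0 < c ->
  exists n : nat, forall k : nat, (n <= k)%N -> M <= c * k%:R.
Proof.
move=> c0; exists (Num.truncn (`|M| / c)).+1 => k nk.
have : `|M| / c <= k%:R.
  apply: le_trans (ltW (truncnS_gt _)) _; by rewrite ler_nat.
by rewrite ler_pdivrMr// mulrC; apply: le_trans; exact: ler_norm.
Qed.

(** The constants [K], [th] and [h0] are fixed before the path and the target, so that the finitely
    many exceptional events of a scale can be chosen before the sample point. *)
Theorem frac_near_target_uniform (R : realType) (a b p e m1 m2 y0 : R) (N : nat) :
  0 < a -> a <= b -> 0 < p -> 0 < e -> m2 < m1 ->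
  exists K th h0, [/\ (0 < K)%N, 0 < th &
    forall h n rho y1 y2 d1 d2 x w1 w2 bad, (h0 <= h)%N ->
      (K * h <= n < K * h + K)%N ->
      y1 0%N + y2 0%N = y0 ->
      urn_path a b y1 y2 d1 d2 x w1 w2 ->
      good_scale y1 y2 d1 d2 x w1 w2 bad N h K p e th rho m1 m2 ->
      `|frac y1 y2 n - rho| <= 4 * e].
Proof.
move=> a0 ab p0 e0 m12; have b0 : 0 < b by lra.
pose A := p ^+ 2 * (m1 - m2); pose B := p ^+ 2 * a.
(* Budget: in the upward drift [g], [2 * (sg * b)] and [(8 + b) * th] each take at most a quarter of
   [A]; in the downward drift [g] and [(2 * b + 4) * th] each take at most half of [B]. *)
have A0 : 0 < A by rewrite mulr_gt0 ?exprn_gt0//; lra.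
have B0 : 0 < B by rewrite mulr_gt0 ?exprn_gt0.
pose sg := Num.min e (A / (8 * b)).
have sg0 : 0 < sg by rewrite lt_min e0 divr_gt0// mulr_gt0.
pose th := Num.min (a * p / 8)
  (Num.min (A / (4 * (8 + b))) (B / (2 * (2 * b + 4)))).
have b8 : 0 < 8 + b by lra.
have b4 : 0 < 2 * b + 4 by lra.
have th0 : 0 < th by rewrite !lt_min !divr_gt0// !mulr_gt0.
pose g := Num.min (A / 4) (B / 2).
have g0 : 0 < g by rewrite lt_min !divr_gt0.
pose c := a * p / 2.
have c0 : 0 < c by rewrite divr_gt0// mulr_gt0.
have [j0 Hj0] := archi_nat b (mulr_gt0 sg0 c0).
(* The successor makes the first block index positive, and the level [2 * b / g] makes the total
   drift at least 1. *)
have [K jK HK] := harmonic_tail_unbounded j0.+1 (2 * b / g).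
have [ha Hha] := archi_nat y0 b0.
have [hb Hhb] := archi_nat b (mulr_gt0 e0 c0).
have th1 : th <= A / (4 * (8 + b)) by rewrite !ge_min lexx orbT.
have th2 : th <= B / (2 * (2 * b + 4)) by rewrite !ge_min lexx !orbT.
have th3 : th <= a * p / 8 by rewrite ge_min lexx.
have sg2 : sg <= e by rewrite ge_min lexx.
have sg1 : sg <= A / (8 * b) by rewrite ge_min lexx orbT.
have g1 : g <= A / 4 by rewrite ge_min lexx.
have g2 : g <= B / 2 by rewrite ge_min lexx orbT.
clearbody th sg g.
exists K, th, (ha + hb + (4 * N).+1)%N; split => //; first exact: leq_trans jK.
move=> h n rho y1 y2 d1 d2 x w1 w2 bad hh Hn y0E Hp Hg.
have [h1 h2 h3] : [/\ (ha <= h)%N, (hb <= h)%N & (4 * N < h)%N].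
  by clear -hh; split; lia.
apply: (@frac_near_target _ _ _ _ _ _ _ _ _ _ _ Hp N h K j0.+1 p e th
  rho m1 m2 g sg Hg) => //.
- exact: ltW.
- exact: ltW.
- by have := Hj0 j0.+1 (leqnSn _); rewrite mulrA.
- exact: ltW.
- rewrite -/A; move: th1 sg1; rewrite !ler_pdivlMr ?mulr_gt0//; lra.
- rewrite -/B; move: th2; rewrite !ler_pdivlMr ?mulr_gt0//; lra.
- by rewrite y0E; apply: Hha.
- apply: (@le_trans _ _ (g / (2 * b) * (2 * b / g))).
    by rewrite le_eqVlt; apply/orP; left; apply/eqP; field; rewrite !gt_eqF.
  by apply: ler_wpM2l HK; rewrite divr_ge0 ?mulr_ge0 ?ltW.
- by rewrite mulrA; apply: Hhb.
Qed.

(** * Orthogonal sums and independence *)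

Lemma measurable_natr_bool d (T : measurableType d) (R : realType)
    (f : T -> bool) :
  measurable_fun [set: T] f -> measurable_fun [set: T] (fun w => (f w)%:R : R).
Proof.
move=> mf; have -> : (fun w => (f w)%:R : R) = (fun w => if f w then 1 else 0).
  by apply/funext => w; case: (f w).
by apply: measurable_fun_ifT => //; exact: measurable_cst.
Qed.

Section bounded_variables.
Context d (T : measurableType d) (R : realType) (P : probability T R).
Implicit Types (f g : T -> R).

(** A class stable under sums and products whose members are all integrable, which settles every
    integrability condition below. *)
Definition bounded_measurable f :=
  measurable_fun [set: T] f /\ exists M, forall w, `|f w| <= M.

Lemma bounded_measurable_integrable f :
  bounded_measurable f -> P.-integrable [set: T] (EFin \o f).
Proof.
case=> mf [M fM]; apply: measurable_bounded_integrable => //.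
  by rewrite (le_lt_trans (probability_le1 _ _))// ltry.
exists M; split; first exact: num_real.
by move=> N MN w _; exact: le_trans (fM w) (ltW MN).
Qed.

Lemma bounded_measurable_cst c : bounded_measurable (fun=> c).
Proof. by split; [exact: measurable_cst|exists `|c|]. Qed.

Lemma bounded_measurableD f g : bounded_measurable f -> bounded_measurable g ->
  bounded_measurable (fun w => f w + g w).
Proof.
case=> mf [M fM] [mg [N gN]]; split; first exact: measurable_funD.
by exists (M + N) => w; rewrite (le_trans (ler_normD _ _))// lerD.
Qed.

Lemma bounded_measurableM f g : bounded_measurable f -> bounded_measurable g ->
  bounded_measurable (fun w => f w * g w).
Proof.
case=> mf [M fM] [mg [N gN]]; split; first exact: measurable_funM.
by exists (M * N) => w; rewrite normrM ler_pM.
Qed.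

Lemma bounded_measurable_sum n (X : nat -> T -> R) :
  (forall i, bounded_measurable (X i)) ->
  bounded_measurable (fun w => \sum_(0 <= i < n) X i w).
Proof.
move=> bX; elim: n => [|n IH].
  by under eq_fun do rewrite big_geq//; exact: bounded_measurable_cst.
by under eq_fun do rewrite big_nat_recr//=; exact: bounded_measurableD.
Qed.

Lemma Rintegral_sum n (X : nat -> T -> R) :
  (forall i, bounded_measurable (X i)) ->
  \int[P]_w (\sum_(0 <= i < n) X i w) = \sum_(0 <= i < n) \int[P]_w X i w.
Proof.
move=> bX; elim: n => [|n IH].
  rewrite big_geq//; under eq_Rintegral do rewrite big_geq//.
  by rewrite Rintegral_cst// mul0r.
rewrite big_nat_recr//= -IH -RintegralD//.
- by apply: eq_Rintegral => w _; rewrite big_nat_recr.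
- exact/bounded_measurable_integrable/bounded_measurable_sum.
- exact: bounded_measurable_integrable.
Qed.

(** Induction on [n]: when the square is expanded, the cross terms with the last summand integrate
    to 0. *)
Lemma orthogonal_sum_second_moment n (X : nat -> T -> R) (C : R) :
  (forall i, measurable_fun [set: T] (X i)) ->
  (forall i w, `|X i w| <= C) ->
  (forall i l, (i < l)%N -> \int[P]_w (X i w * X l w) = 0) ->
  \int[P]_w ((\sum_(0 <= i < n) X i w) ^+ 2) <= n%:R * C ^+ 2.
Proof.
move=> mX XC orth.
have bX i : bounded_measurable (X i) by split => //; exists C.
have C0 : 0 <= C by exact: le_trans (normr_ge0 _) (XC 0%N point).
elim: n => [|n IH].
  under eq_Rintegral do rewrite big_geq// expr0n/=.
  by rewrite Rintegral_cst// !mul0r.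
pose S w := \sum_(0 <= i < n) X i w.
have bS : bounded_measurable S by exact: bounded_measurable_sum.
have -> : \int[P]_w ((\sum_(0 <= i < n.+1) X i w) ^+ 2) =
    \int[P]_w (S w ^+ 2) + \int[P]_w (\sum_(0 <= i < n) 2 * (X i w * X n w))
    + \int[P]_w (X n w ^+ 2).
  have b1 : bounded_measurable (fun w => S w ^+ 2).
    exact: bounded_measurableM.
  have b2 : bounded_measurable (fun w => \sum_(0 <= i < n) 2 * (X i w * X n w)).
    apply: (@bounded_measurable_sum _ (fun i w => 2 * (X i w * X n w))) => i.
    apply: bounded_measurableM; first exact: bounded_measurable_cst.
    exact: bounded_measurableM.
  have b3 : bounded_measurable (fun w => X n w ^+ 2).
    exact: bounded_measurableM.
  rewrite -RintegralD//; [|exact: bounded_measurable_integrable..].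
  rewrite -RintegralD//; [|apply: bounded_measurable_integrable => //..].
    apply: eq_Rintegral => w _; rewrite big_nat_recr//= -mulr_sumr -mulr_suml.
    by rewrite -/(S w); ring.
  exact: bounded_measurableD.
rewrite (@Rintegral_sum _ (fun i w => 2 * (X i w * X n w))); last first.
  move=> i; apply: bounded_measurableM; first exact: bounded_measurable_cst.
  exact: bounded_measurableM.
rewrite big1_seq ?addr0; last first.
  move=> i; rewrite mem_index_iota => /andP[_ /andP[_ ni]].
  rewrite RintegralZl// ?orth ?mulr0//.
  by apply: bounded_measurable_integrable; exact: bounded_measurableM.
rewrite -natr1 mulrDl mul1r lerD//.
apply: (@le_trans _ _ (\int[P]_w (C ^+ 2))).
  apply: le_Rintegral => //.
  - by apply: bounded_measurable_integrable; exact: bounded_measurableM.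
  - exact/bounded_measurable_integrable/bounded_measurable_cst.
  - by move=> w _; rewrite -[X n w ^+ 2]ger0_norm ?sqr_ge0// normrX lerXn2r ?nnegrE.
rewrite Rintegral_cst//.
have E : fine (P [set: T]) = 1 by rewrite probability_setT.
by rewrite [fine _]E mulr1.
Qed.

Lemma bounded_measurable_indic A : measurable A ->
  bounded_measurable (\1_A : T -> R).
Proof.
move=> mA; split; first exact: measurable_indic.
by exists 1 => w; rewrite indicE ger0_norm ?ler0n// lern1 leq_b1.
Qed.

Lemma Rintegral_indic A : measurable A -> \int[P]_w (\1_A w : R) = fine (P A).
Proof. by move=> mA; rewrite /Rintegral integral_indic// setIT. Qed.

Lemma measurable_pred (f : T -> bool) : measurable_fun [set: T] f ->
  measurable [set w | f w].
Proof.
move=> mf; rewrite -[X in measurable X]setTI.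
exact: (mf measurableT [set true]).
Qed.

Lemma measurable_ge f (c : R) : measurable_fun [set: T] f ->
  measurable [set w | c <= f w].
Proof.
move=> mf; rewrite -[X in measurable X]setTI.
by rewrite -preimage_itvcy; exact: mf.
Qed.

Lemma markov_bounded f (c : R) : 0 < c -> bounded_measurable f ->
  (forall w, 0 <= f w) -> fine (P [set w | c <= f w]) <= (\int[P]_w f w) / c.
Proof.
move=> c0 bf f0; have mA := measurable_ge c bf.1.
rewrite ler_pdivlMr// -Rintegral_indic// mulrC.
have bI := bounded_measurable_indic mA.
rewrite -RintegralZl//; last exact: bounded_measurable_integrable.
apply: le_Rintegral => //.
- apply: bounded_measurable_integrable; apply: bounded_measurableM => //.
  exact: bounded_measurable_cst.
- exact: bounded_measurable_integrable.
move=> w _; rewrite indicE; case: (boolP (w \in _)) => [|_].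
  by rewrite inE/= mulr1.
by rewrite mulr0.
Qed.

Lemma orthogonal_sum_deviation n (X : nat -> T -> R) (C t : R) :
  0 < t ->
  (forall i, measurable_fun [set: T] (X i)) ->
  (forall i w, `|X i w| <= C) ->
  (forall i l, (i < l)%N -> \int[P]_w (X i w * X l w) = 0) ->
  fine (P [set w | t < `|\sum_(0 <= i < n) X i w|]) <= n%:R * C ^+ 2 / t ^+ 2.
Proof.
move=> t0 mX XC orth.
have bX i : bounded_measurable (X i) by split => //; exists C.
have bS := bounded_measurable_sum n bX.
have bSS := bounded_measurableM bS bS.
have mA : measurable [set w | t < `|\sum_(0 <= i < n) X i w|].
  apply: measurable_pred; apply: measurable_fun_ltr => //.
  by apply: measurableT_comp bS.1.
have mB : measurable [set w | t ^+ 2 <= (\sum_(0 <= i < n) X i w) ^+ 2].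
  exact: (@measurable_ge _ _ bSS.1).
apply: le_trans
  (_ : fine (P [set w | t ^+ 2 <= (\sum_(0 <= i < n) X i w) ^+ 2]) <= _).
  rewrite fine_le ?fin_num_measure//; apply: le_measure; rewrite ?inE//.
  move=> w /= tw; rewrite -[leRHS]ger0_norm ?sqr_ge0// normrX.
  by rewrite lerXn2r// ?nnegrE// ltW.
apply: le_trans (markov_bounded (exprn_gt0 2 t0) bSS _) _.
  by move=> w; exact: sqr_ge0.
apply: ler_wpM2r; first by rewrite invr_ge0 exprn_ge0// ltW.
exact: (orthogonal_sum_second_moment n mX XC orth).
Qed.

End bounded_variables.

(** * Integrals of functions of independent variables *)

Section independent_integral.
Context d d1 d2 (T : measurableType d) (X : measurableType d1)
  (Y : measurableType d2) (R : realType) (P : probability T R).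
Variables (V : {mfun T >-> X}) (W : {mfun T >-> Y}).
Hypothesis VW : forall A B, measurable A -> measurable B ->
  P (V @^-1` A `&` W @^-1` B) = (P (V @^-1` A) * P (W @^-1` B))%E.

Local Open Scope ereal_scope.

(** Fubini, in place of a conditional expectation: the law of the pair is the product of the laws,
    and the outer integral is pulled back to [T], so the inner one has to vanish only at the values
    [V v]. *)
Lemma independent_integral_eq0 (f : X * Y -> R) (M : R) :
  measurable_fun [set: X * Y] f -> (forall v w, (`|f (V v, W w)| <= M)%R) ->
  (forall v, \int[P]_w (f (V v, W w))%:E = 0) ->
  \int[P]_w (f (V w, W w))%:E = 0.
Proof.
move=> mf fM f0.
pose VWf := fun w => (V w, W w).
have mVW : measurable_fun [set: T] VWf by exact: measurable_fun_pair.
pose VWm : {mfun T >-> (X * Y)%type} :=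
  HB.pack VWf (isMeasurableFun.Build _ _ _ _ _ mVW).
have law B : measurable B ->
    (distribution P V \x distribution P W) B = distribution P VWm B.
  move=> mB; apply: (@product_measure_unique _ _ _ _ _ (distribution P V)
    (distribution P W) (distribution P VWm)).
  - by move=> A C mA mC; exact: VW.
  - exact: mB.
have bf : bounded_measurable (f \o VWm).
  by split; [exact: (measurableT_comp mf mVW)|exists M => w; exact: fM].
have mfE : measurable_fun [set: X * Y] (EFin \o f) by exact/measurable_EFinP.
have intf : (distribution P V \x distribution P W).-integrable setT (EFin \o f).
  apply/integrableP; split => //.
  rewrite (@eq_measure_integral _ _ _ _ (distribution P VWm)); last first.
    by move=> B mB _; exact: law.
  rewrite ge0_integral_distribution//; last exact: measurableT_comp.
  by have /integrableP[_] := bounded_measurable_integrable P bf.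
transitivity (\int[distribution P VWm]_z (f z)%:E).
  rewrite integral_distribution//.
  exact: bounded_measurable_integrable.
transitivity (\int[distribution P V \x distribution P W]_z (f z)%:E).
  by apply: eq_measure_integral => B mB _; exact/esym/law.
rewrite -(@integral12_prod_meas1 _ _ _ _ _ _ _ (EFin \o f))//.
have F0 v : fubini_F (distribution P W) (EFin \o f) (V v) = 0.
  rewrite /fubini_F integral_distribution.
  - exact: f0.
  - exact: measurable_fun_pair2 (V v) mfE.
  - apply: (@bounded_measurable_integrable _ _ _ P (fun w => f (V v, W w))).
    split; last by exists M => w; exact: fM.
    exact: (measurableT_comp (measurable_fun_pair2 (V v) mf)).
rewrite integral_distribution.
- by apply: integral0_eq => w _; exact: F0.
- exact: (measurable_fubini_F intf).
- by apply: eq_integrable (integrable0 _ _) => // w _; rewrite /= F0.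
Qed.

End independent_integral.

Section independent_corollaries.
Context d (T : measurableType d) (R : realType) (P : probability T R).

Lemma independent_mul_integral0 (K L : T -> R) :
  bounded_measurable K -> bounded_measurable L ->
  (forall A B, measurable A -> measurable B ->
    P (K @^-1` A `&` L @^-1` B) = (P (K @^-1` A) * P (L @^-1` B))%E) ->
  \int[P]_w L w = 0 -> \int[P]_w (K w * L w) = 0.
Proof.
move=> [mK [M KM]] [mL [N LN]] KL L0.
have bL : bounded_measurable L by split => //; exists N.
pose Km : {mfun T >-> R} := HB.pack K (isMeasurableFun.Build _ _ _ _ _ mK).
pose Lm : {mfun T >-> R} := HB.pack L (isMeasurableFun.Build _ _ _ _ _ mL).
have H := @independent_integral_eq0 _ _ _ T _ _ R P Km Lm KL
  (fun z : R * R => z.1 * z.2) (M * N).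
rewrite /Rintegral H//.
- apply: measurable_funM; [exact: measurable_fst|exact: measurable_snd].
- by move=> v w; rewrite normrM; apply: ler_pM => //; [exact: KM|exact: LN].
move=> v /=.
under eq_integral do rewrite EFinM.
have iL := bounded_measurable_integrable P bL.
rewrite integralZl//.
have -> : (\int[P]_w (L w)%:E)%E = 0%E.
  by rewrite -[LHS]fineK ?integrable_fin_num// -/(Rintegral _ _ _) L0.
by rewrite mule0.
Qed.

Lemma uniform_le_integral (U : T -> R) (z : R) : measurable_fun [set: T] U ->
  (forall B, measurable B -> P (U @^-1` B) = lebesgue_measure (B `&` `]0, 1[)) ->
  0 <= z <= 1 -> \int[P]_w ((U w <= z)%R%:R - z) = 0.
Proof.
move=> mU lawU z01.
have mI : measurable [set w | (U w <= z)%R].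
  by apply: measurable_pred; exact: measurable_fun_ler.
have PI : P [set w | (U w <= z)%R] = z%:E.
  have -> : [set w | (U w <= z)%R] = U @^-1` `]-oo, z]%classic.
    by apply/seteqP; split => w /=; rewrite in_itv.
  (* The endpoint [z = 1] is apart: the half-line then meets the open unit interval in []0, 1[] and
     not in []0, z]]. *)
  rewrite lawU//; case/andP: z01 => z0; rewrite le_eqVlt => /predU1P[->|z1].
    have -> : (`]-oo, 1%R] `&` `]0, 1[ = `]0, 1[ :> set R)%classic.
      by apply/seteqP; split => x /=; rewrite !in_itv/=; [case|lra].
    by rewrite lebesgue_measure_itv/= lte_fin ltr01 oppr0 adde0.
  have -> : (`]-oo, z] `&` `]0, 1[ = `]0, z] :> set R)%classic.
    apply/seteqP; split => x /=; rewrite !in_itv/=.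
      by move=> [? /andP[? ?]]; apply/andP.
    by move=> /andP[? ?]; split => //; apply/andP; split => //; lra.
  rewrite lebesgue_measure_itv/= lte_fin; case: ifPn => [_|].
    by rewrite oppr0 adde0.
  by rewrite -leNgt => z_le0; congr EFin; apply: le_anti; rewrite z0.
have bI := bounded_measurable_indic R mI.
have bz := bounded_measurable_cst T z.
have -> : (fun w => (U w <= z)%R%:R - z) =
    (fun w => \1_[set w | (U w <= z)%R] w - z).
  apply/funext => w; rewrite indicE.
  have -> // : (w \in [set w | (U w <= z)%R]) = (U w <= z)%R.
  by apply/idP/idP; rewrite inE.
rewrite RintegralB//; [|exact: bounded_measurable_integrable..].
rewrite Rintegral_indic// PI/= Rintegral_cst//.
have E : fine (P [set: T]) = 1 by rewrite probability_setT.
by rewrite [fine (P setT)]E mulr1 subrr.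
Qed.

(** The martingale property in integrated form: once the pair of [Z] and [K] is fixed, the indicator
    of [U <= Z] has mean [Z]. *)
Lemma uniform_threshold_integral0 (U Z K : T -> R) :
  measurable_fun [set: T] U -> measurable_fun [set: T] Z ->
  bounded_measurable K ->
  (forall B, measurable B -> P (U @^-1` B) = lebesgue_measure (B `&` `]0, 1[)) ->
  (forall w, 0 <= Z w <= 1) ->
  (forall A B, measurable A -> measurable B ->
    P ((fun w => (Z w, K w)) @^-1` A `&` U @^-1` B) =
    (P ((fun w => (Z w, K w)) @^-1` A) * P (U @^-1` B))%E) ->
  \int[P]_w (K w * ((U w <= Z w)%R%:R - Z w)) = 0.
Proof.
move=> mU mZ [mK [M KM]] lawU Z01 ind.
have mV : measurable_fun [set: T] (fun w => (Z w, K w)).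
  exact: measurable_fun_pair.
pose V : {mfun T >-> (R * R)%type} := HB.pack (fun w => (Z w, K w))
   (isMeasurableFun.Build _ _ _ _ _ mV).
pose Um : {mfun T >-> R} := HB.pack U (isMeasurableFun.Build _ _ _ _ _ mU).
have H := @independent_integral_eq0 _ _ _ T _ _ R P V Um ind
  (fun z : R * R * R => z.1.2 * ((z.2 <= z.1.1)%R%:R - z.1.1)) M.
rewrite /Rintegral H//.
- apply: measurable_funM.
    exact: measurableT_comp measurable_snd measurable_fst.
  have m11 : measurable_fun [set: R * R * R] (fun z => z.1.1).
    exact: measurableT_comp measurable_fst measurable_fst.
  apply: measurable_funB => //.
  by apply: measurable_natr_bool; exact: measurable_fun_ler.
- move=> v w /=; rewrite normrM -[leRHS]mulr1; apply: ler_pM => //.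
  by have := Z01 v; case: (U w <= Z v)%R => /=; rewrite ler_norml; lra.
move=> v /=; under eq_integral do rewrite EFinM.
have bI : bounded_measurable (fun w => (U w <= Z v)%R%:R - Z v).
  split; last first.
    exists 1 => w; have := Z01 v.
    by case: (U w <= Z v)%R => /=; rewrite ler_norml; lra.
  apply: measurable_funB => //.
  by apply: measurable_natr_bool; exact: measurable_fun_ler.
have iI := bounded_measurable_integrable P bI.
rewrite integralZl//.
have -> : (\int[P]_w ((U w <= Z v)%R%:R - Z v)%:E)%E = 0%E.
  rewrite -[LHS]fineK ?integrable_fin_num// -/(Rintegral _ _ _).
  by rewrite uniform_le_integral.
by rewrite mule0.
Qed.

End independent_corollaries.

(** * Independence of generated sigma-algebras *)

Section independence.
Context d (T : measurableType d) (R : realType) (P : probability T R).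

(** Uniqueness of measures: [C] maps to [P (C & E)] and to [P C * P E] by two finite measures that
    agree on a pi-system containing the whole space. *)
Lemma independent_g_sigma_algebra (G : set (set T)) (E : set T) :
  G `<=` measurable -> G setT -> setI_closed G -> measurable E ->
  (forall C, G C -> P (C `&` E) = (P C * P E)%E) ->
  forall C, <<s G >> C -> P (C `&` E) = (P C * P E)%E.
Proof.
move=> Gm GT GI mE H C sC.
have [q p0 pE] : exists2 q : R, 0 <= q & P E = q%:E.
  by exists (fine (P E)); rewrite ?fine_ge0// fineK// fin_num_measure.
have := @g_sigma_algebra_measure_unique _ R T G Gm (fun=> setT) (fun=> GT) _
  (mrestr P mE) (mscale (NngNum p0) P) GI.
move=> /(_ _ _ _ C sC); rewrite /mrestr /mscale/= muleC pE; apply.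
- by apply/seteqP; split => // x _; exists 0%N.
- by move=> A GA; rewrite /mrestr /mscale/= H// pE muleC.
- by move=> _; rewrite (le_lt_trans (probability_le1 _ _)) ?ltry//; exact: measurableI.
Qed.

Variables (I : eqType) (G : I -> set (set T)).
Hypothesis Gind : mutually_independent P G.
Hypothesis Gm : forall i, G i `<=` measurable.
Hypothesis GT : forall i, G i setT.
Hypothesis GI : forall i, setI_closed (G i).

Definition cylinders (J : seq I) : set (set T) :=
  [set C | exists2 A : I -> set T, (forall i, i \in J -> G i (A i)) &
                                   C = \big[setI/setT]_(i <- J) A i].

Lemma sub_cylinders (J : seq I) (i : I) : uniq J -> i \in J -> G i `<=` cylinders J.
Proof.
move=> uJ iJ C GC; exists (fun j => if j == i then C else setT).
  by move=> j _; case: eqP => [->|].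
by rewrite (bigD1_seq i)//= eqxx big1 ?setIT// => j /negbTE ->.
Qed.

Lemma cylinders_independent (J : seq I) (l : I) : uniq J -> l \notin J ->
  forall C E, <<s cylinders J >> C -> G l E -> P (C `&` E) = (P C * P E)%E.
Proof.
move=> uJ lJ C E sC GE; apply: independent_g_sigma_algebra sC => //.
- move=> _ [A GA ->]; elim: J {uJ lJ} GA => [_|j J IH GA].
    by rewrite big_nil.
  rewrite big_cons; apply: measurableI.
    by apply: Gm; apply: GA; rewrite mem_head.
  by apply: IH => i iJ; apply: GA; rewrite in_cons iJ orbT.
- exists (fun=> setT); first by [].
  by rewrite big1.
- move=> _ _ [A GA ->] [B GB ->]; exists (fun i => A i `&` B i).
    by move=> i iJ; apply: GI; [exact: GA|exact: GB].
  by rewrite big_split.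
- exact: Gm GE.
move=> _ [A GA ->].
(* Mutual independence is used twice, for [l :: J] with [E] placed at index [l], and for [J] alone;
   the quotient is the claim. *)
pose A' i := if i == l then E else A i.
have AA' : {in J, A =1 A'}.
  by move=> i iJ; rewrite /A'; case: eqP => // il; rewrite -il iJ in lJ.
have A'l : A' l = E by rewrite /A' eqxx.
have H1 : P (\big[setI/setT]_(i <- l :: J) A' i) =
    (\prod_(i <- l :: J) fine (P (A' i)))%:E.
  apply: Gind; first by rewrite /= lJ.
  move=> i; rewrite in_cons => /predU1P[->|iJ]; first by rewrite A'l.
  by rewrite -AA'//; exact: GA.
have H2 : P (\big[setI/setT]_(i <- J) A i) = (\prod_(i <- J) fine (P (A i)))%:E.
  exact: Gind.
move: H1; rewrite !big_cons A'l setIC (eq_big_seq _ (fun i iJ => esym (AA' i iJ))).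
move=> ->; rewrite EFinM fineK ?fin_num_measure//; last exact: Gm GE.
rewrite muleC H2; congr (_%:E * _)%E.
by apply: eq_big_seq => i iJ; rewrite -AA'.
Qed.

End independence.

Lemma setI_closed_sigma_of d (T : Type) (T' : measurableType d) (X : T -> T') :
  setI_closed (sigma_of X).
Proof.
move=> _ _ [A mA ->] [B mB ->]; exists (A `&` B); first exact: measurableI.
by rewrite preimage_setI.
Qed.

Lemma sigma_of_setT d (T : Type) (T' : measurableType d) (X : T -> T') :
  sigma_of X setT.
Proof. by exists setT. Qed.

Lemma sigma_of_measurable d d' (T : measurableType d) (T' : measurableType d')
  (X : T -> T') : measurable_fun [set: T] X -> sigma_of X `<=` measurable.
Proof. by move=> mX _ [B mB ->]; rewrite -[X in measurable X]setTI; exact: mX. Qed.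

(** * Measurability of the urn and of the thresholds *)

Section urn_measurability.
Context d dS dF (T : measurableType d) (S : measurableType dS)
  (Phi : measurableType dF) (R : realType).
Variables (u : S -> R) (xi1 xi2 : nat -> T -> S) (U : nat -> T -> R)
  (phi : nat -> T -> Phi) (rho1hat rho2hat : nat -> T -> R) (y10 y20 : R).

Local Notation Y1 := (urnY1 u xi1 xi2 U rho1hat rho2hat y10 y20).
Local Notation Y2 := (urnY2 u xi1 xi2 U rho1hat rho2hat y10 y20).
Local Notation Z := (urnZ u xi1 xi2 U rho1hat rho2hat y10 y20).
Local Notation X := (urnX u xi1 xi2 U rho1hat rho2hat y10 y20).
Local Notation F := (urnF u xi1 xi2 U rho1hat rho2hat y10 y20 phi).

Lemma urnY1S n w : Y1 n.+1 w = Y1 n w +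
  ((U n.+1 w <= Z n w)%R && (Z n w <= rho1hat n w)%R)%:R * u (xi1 n.+1 w).
Proof.
rewrite /urnZ /urnY1 /urnY2 /=; case: (urnY _ _ _ _ _ _ _ _ n w) => y1 y2 /=.
by case: ifP => _; rewrite ?mul1r ?mul0r.
Qed.

Lemma urnY2S n w : Y2 n.+1 w = Y2 n w +
  (~~ (U n.+1 w <= Z n w)%R && (rho2hat n w <= Z n w)%R)%:R * u (xi2 n.+1 w).
Proof.
rewrite /urnZ /urnY1 /urnY2 /=; case: (urnY _ _ _ _ _ _ _ _ n w) => y1 y2 /=.
by case: ifP => _; rewrite ?mul1r ?mul0r.
Qed.

Variable N : nat.
Hypothesis mu : measurable_fun [set: S] u.
Hypothesis u_ge0 : forall s, 0 <= u s.
Hypothesis y10_gt0 : 0 < y10.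
Hypothesis y20_gt0 : 0 < y20.
Hypothesis mxi1 : forall n, measurable_fun [set: T] (xi1 n).
Hypothesis mxi2 : forall n, measurable_fun [set: T] (xi2 n).
Hypothesis mphi : forall n, measurable_fun [set: T] (phi n).
Hypothesis mU : forall n, (n < N)%N -> measurable_fun [set: T] (U n.+1).
Hypothesis Frho1 : forall n (B : set R), measurable B -> F n (rho1hat n @^-1` B).
Hypothesis Frho2 : forall n (B : set R), measurable B -> F n (rho2hat n @^-1` B).

Lemma urnY1_gt0 n w : 0 < Y1 n w.
Proof.
elim: n => [//|n IH]; rewrite urnY1S ltr_wpDr// mulr_ge0//.
Qed.

Lemma urnY2_gt0 n w : 0 < Y2 n w.
Proof.
elim: n => [//|n IH]; rewrite urnY2S ltr_wpDr// mulr_ge0//.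
Qed.

Let measurable_Z n : measurable_fun [set: T] (Y1 n) ->
  measurable_fun [set: T] (Y2 n) -> measurable_fun [set: T] (Z n).
Proof.
move=> m1 m2.
(* On positive reals the inverse is the power of exponent -1, which is a measurable function. *)
have -> : Z n = fun w => Y1 n w * (Y1 n w + Y2 n w) `^ (-1).
  apply/funext => w; rewrite /urnZ powR_inv1// addr_ge0// ltW//.
    exact: urnY1_gt0.
  exact: urnY2_gt0.
apply: measurable_funM => //.
apply: (@measurableT_comp _ _ _ _ _ _ (fun x : R => x `^ (-1))).
  exact: measurable_powR.
exact: measurable_funD.
Qed.

Let measurable_F n : (n <= N)%N ->
  (forall k, (k < n)%N -> measurable_fun [set: T] (Z k)) -> F n `<=` measurable.
Proof.
move=> nN mZ; apply: smallest_sub; first exact: sigma_algebra_measurable.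
have mUZ k : (k < n)%N -> measurable_fun [set: T] (fun w => (U k.+1 w <= Z k w)%R).
  move=> kn; apply: measurable_fun_ler; last exact: mZ.
  exact/mU/(leq_trans kn).
move=> A [[|k]/= kn]; first by [].
case=> [[]|].
- apply: sigma_of_measurable; apply: measurable_natr_bool; exact: mUZ.
- apply: sigma_of_measurable; rewrite /urnObs.
  apply: measurable_fun_ifT => //.
  apply: measurable_fun_eqr => //; apply: measurable_natr_bool; exact: mUZ.
- exact: sigma_of_measurable.
Qed.

(** The thresholds at time [n] are measurable for [F n], which is itself generated by draws
    depending on earlier thresholds. The induction breaks the circle: [Z k] for [k < n] gives [F n],
    then the thresholds at [n], then the composition at [n.+1]. The horizon [N] allows [T] to carry
    a sigma-algebra containing only the first [N] uniforms. *)
Lemma measurable_urn n : (n <= N)%N ->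
  [/\ measurable_fun [set: T] (Z n), measurable_fun [set: T] (rho1hat n)
    & measurable_fun [set: T] (rho2hat n)].
Proof.
suff H : forall n, (n <= N)%N ->
    measurable_fun [set: T] (Y1 n) /\ measurable_fun [set: T] (Y2 n) /\
    forall k, (k < n)%N -> measurable_fun [set: T] (Z k) /\
      measurable_fun [set: T] (rho1hat k) /\ measurable_fun [set: T] (rho2hat k).
  move=> nN; have [m1 [m2 mk]] := H n nN.
  have mF := measurable_F nN (fun k kn => (mk k kn).1).
  split; first exact: measurable_Z.
    by move=> _ B mB; rewrite setTI; apply: mF; exact: Frho1.
  by move=> _ B mB; rewrite setTI; apply: mF; exact: Frho2.
elim=> [_|{}n IH nN].
  by split; [exact: measurable_cst|split => //; exact: measurable_cst].
have [m1 [m2 mk]] := IH (ltnW nN).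
have mF := measurable_F (ltnW nN) (fun k kn => (mk k kn).1).
have mZ := measurable_Z m1 m2.
have mr1 : measurable_fun [set: T] (rho1hat n).
  by move=> _ B mB; rewrite setTI; apply: mF; exact: Frho1.
have mr2 : measurable_fun [set: T] (rho2hat n).
  by move=> _ B mB; rewrite setTI; apply: mF; exact: Frho2.
have mUn := mU nN.
have mUZ : measurable_fun [set: T] (fun w => (U n.+1 w <= Z n w)%R).
  exact: measurable_fun_ler.
split; [|split].
- rewrite (_ : Y1 n.+1 = fun w => Y1 n w + ((U n.+1 w <= Z n w)%R &&
    (Z n w <= rho1hat n w)%R)%:R * u (xi1 n.+1 w)); last first.
    by apply/funext => w; exact: urnY1S.
  apply: measurable_funD => //; apply: measurable_funM; last exact: measurableT_comp.
  apply: measurable_natr_bool; apply: measurable_and => //; exact: measurable_fun_ler.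
- rewrite (_ : Y2 n.+1 = fun w => Y2 n w + (~~ (U n.+1 w <= Z n w)%R &&
    (rho2hat n w <= Z n w)%R)%:R * u (xi2 n.+1 w)); last first.
    by apply/funext => w; exact: urnY2S.
  apply: measurable_funD => //; apply: measurable_funM; last exact: measurableT_comp.
  apply: measurable_natr_bool; apply: measurable_and.
    exact: measurable_neg.
  exact: measurable_fun_ler.
- move=> k; rewrite ltnS leq_eqVlt => /predU1P[->//|]; exact: mk.
Qed.

End urn_measurability.

(** * Events of vanishing probability *)

Section vanishing_events.
Context d (T : measurableType d) (R : realType) (P : probability T R).

Lemma fine_probability_le (A B : set T) : measurable A -> measurable B ->
  A `<=` B -> fine (P A) <= fine (P B).
Proof.
by move=> mA mB AB; rewrite fine_le ?fin_num_measure// le_measure ?inE.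
Qed.

Lemma fine_probabilityU (A B : set T) : measurable A -> measurable B ->
  fine (P (A `|` B)) <= fine (P A) + fine (P B).
Proof.
move=> mA mB; rewrite -fineD ?fin_num_measure//.
rewrite fine_le ?fin_numD ?fin_num_measure//; first exact: measurableU.
exact: measureU2.
Qed.

Lemma fine_probability_ge0 (A : set T) : 0 <= fine (P A).
Proof. exact: fine_ge0. Qed.

(** Measurability is bundled with the limit, and probabilities are taken as reals, so that finite
    unions and comparisons need no side conditions. *)
Definition vanishing (A : nat -> set T) :=
  (forall n, measurable (A n)) /\ (fun n => fine (P (A n))) @ \oo --> (0 : R).

Lemma vanishing_le (A : nat -> set T) (f : nat -> R) :
  (forall n, measurable (A n)) -> (forall n, fine (P (A n)) <= f n) ->
  f @ \oo --> (0 : R) -> vanishing A.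
Proof.
move=> mA Af f0; split=> //.
apply: (@squeeze_cvgr _ _ _ _ (fun=> 0) f) => //; last exact: cvg_cst.
by apply: nearW => n; rewrite fine_probability_ge0 Af.
Qed.

Lemma vanishing0 : vanishing (fun=> set0).
Proof. by split=> //; under eq_fun do rewrite measure0; exact: cvg_cst. Qed.

Lemma vanishingU (A B : nat -> set T) : vanishing A -> vanishing B ->
  vanishing (fun n => A n `|` B n).
Proof.
move=> [mA A0] [mB B0].
apply: (@vanishing_le _ (fun n => fine (P (A n)) + fine (P (B n)))).
- by move=> n; exact: measurableU.
- by move=> n; exact: fine_probabilityU.
- by rewrite -[X in _ --> X]addr0; exact: cvgD.
Qed.

Lemma vanishing_bigU (K : nat) (A : nat -> nat -> set T) :
  (forall j, vanishing (A j)) ->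
  vanishing (fun n => \big[setU/set0]_(0 <= j < K) A j n).
Proof.
move=> vA; elim: K => [|K IH].
  by under eq_fun do rewrite big_geq//; exact: vanishing0.
by under eq_fun do rewrite big_nat_recr//=; exact: vanishingU.
Qed.

Lemma vanishing_comp (A : nat -> set T) (f : nat -> nat) :
  f @ \oo --> \oo -> vanishing A -> vanishing (fun n => A (f n)).
Proof.
move=> foo [mA A0]; split=> //.
exact: (@cvg_comp _ _ _ f (fun n => fine (P (A n))) _ _ _ foo A0).
Qed.

Lemma cvg_inv_nat (c : R) : (fun n : nat => c / n%:R) @ \oo --> (0 : R).
Proof.
rewrite -[X in _ --> X](mulr0 c); apply: cvgM; first exact: cvg_cst.
apply/cvgr0Pnorm_lt => e e0; near=> n.
have n0 : 0 < n%:R :> R by rewrite ltr0n; near: n; exact: nbhs_infty_gt.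
rewrite normfV ger0_norm ?ltW// invf_plt ?posrE//.
by near: n; exact: nbhs_infty_gtr.
Unshelve. all: by end_near. Qed.

Lemma vanishing_orthogonal_sum (X : nat -> T -> R) (C th : R) (j : nat) :
  0 < th ->
  (forall i, measurable_fun [set: T] (X i)) ->
  (forall i w, `|X i w| <= C) ->
  (forall i l, (i < l)%N -> \int[P]_w (X i w * X l w) = 0) ->
  vanishing (fun h => [set w | th * h%:R < `|\sum_(0 <= i < j * h) X i w|]).
Proof.
move=> th0 mX XC orth.
have bX i : bounded_measurable (X i) by split => //; exists C.
have mS h : measurable [set w | th * h%:R < `|\sum_(0 <= i < j * h) X i w|].
  apply: measurable_pred; apply: measurable_fun_ltr => //.
  by apply: measurableT_comp (bounded_measurable_sum _ bX).1.
(* Chebyshev's bound at level [th * h] is of order [1 / h]; at [h = 0], where the level is zero, the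
   trivial bound 1 replaces it. *)
apply: (@vanishing_le _ (fun h =>
  if h == 0%N then 1 else j%:R * C ^+ 2 / th ^+ 2 / h%:R)) => //.
  move=> h; case: eqVneq => [_|h0].
    by rewrite -lee_fin fineK ?fin_num_measure// probability_le1.
  have hp : 0 < h%:R :> R by rewrite ltr0n lt0n.
  apply: le_trans (orthogonal_sum_deviation (j * h) (mulr_gt0 th0 hp) mX XC orth) _.
  rewrite le_eqVlt; apply/orP; left; apply/eqP.
  by rewrite natrM; field; rewrite !gt_eqF.
apply: cvg_trans (cvg_inv_nat (j%:R * C ^+ 2 / th ^+ 2)).
apply: near_eq_cvg; near=> h.
suff -> : (h == 0%N) = false by [].
by apply/negbTE; rewrite -lt0n; near: h; exact: nbhs_infty_gt.
Unshelve. all: by end_near. Qed.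

(** By Cesaro the expected number of occurrences before time [K * h] is o(h), and Markov's
    inequality compares it with [th * h]. *)
Lemma vanishing_occupation (B : nat -> set T) (K : nat) (th : R) : 0 < th ->
  vanishing B ->
  vanishing (fun h => [set w | th * h%:R < \sum_(0 <= i < K * h) \1_(B i) w]).
Proof.
move=> th0 [mB B0].
have bB i := bounded_measurable_indic R (mB i).
have bS n := bounded_measurable_sum n bB.
have mS n (t : R) : measurable [set w | t < \sum_(0 <= i < n) \1_(B i) w].
  by apply: measurable_pred; apply: measurable_fun_ltr => //; exact: (bS n).1.
have S0 n w : 0 <= \sum_(0 <= i < n) (\1_(B i) w : R).
  by apply: sumr_ge0 => i _; rewrite indicE.
pose p i := fine (P (B i)).
have C0 := cesaro B0; rewrite /arithmetic_mean /series/= in C0.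
split=> [h|]; first exact: mS.
apply/cvgr0Pnorm_le => e e0.
have [->|K0] := posnP K.
  apply: nearW => h; under eq_set => w do rewrite mul0n big_geq//.
  rewrite (_ : [set w | _] = set0) ?measure0 ?normr0 ?ltW//.
  apply/seteqP; split => // w /=; rewrite ltNge mulr_ge0//; exact: ltW.
have Kp : 0 < K%:R :> R by rewrite ltr0n.
(* Tolerance for the Cesaro mean: multiplied by [K * h] and divided by [th * h] it becomes [e]. *)
have e1 : 0 < e * th / K%:R by rewrite divr_gt0// mulr_gt0.
move/cvgr0Pnorm_le : C0 => /(_ _ e1) [n0 _ Hn0].
near=> h.
have hp : (0 < h)%N by near: h; exact: nbhs_infty_gt.
have hp' : 0 < h%:R :> R by rewrite ltr0n.
have : (n0 < K * h)%N.
  by apply: leq_trans (leq_pmull _ K0); near: h; exact: nbhs_infty_gt.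
(* The arithmetic mean of index [m] averages [m.+1] terms, hence the predecessor of [K * h]. *)
case E : (K * h)%N => [//|m] n0m; rewrite -E.
have := Hn0 m n0m; rewrite -E => {}Hn0.
rewrite ger0_norm ?fine_probability_ge0//.
apply: (@le_trans _ _
  (fine (P [set w | th * h%:R <= \sum_(0 <= i < K * h) \1_(B i) w]))).
  apply: fine_probability_le; first exact: mS.
    by apply: measurable_ge; exact: (bS _).1.
  by move=> w /=; exact: ltW.
apply: le_trans (markov_bounded P (mulr_gt0 th0 hp') (bS (K * h)%N) (S0 _)) _.
rewrite Rintegral_sum//; under eq_bigr do rewrite Rintegral_indic//.
have := le_trans (ler_norm _) Hn0.
rewrite ler_pdivrMr ?mulr_gt0// ler_pdivrMl ?ltr0n ?muln_gt0 ?K0//.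
move/le_trans; apply; rewrite natrM le_eqVlt; apply/orP; left; apply/eqP.
by field; rewrite gt_eqF.
Unshelve. all: by end_near. Qed.

(** The union bound over the tail gives a geometric series of ratio [expR (- c)]. *)
Lemma exponential_tail (B : nat -> set T) (c : R) :
  0 < c -> (forall i, measurable (B i)) ->
  (\forall n \near \oo, fine (P (B n)) <= expR (- (c * n%:R))) ->
  vanishing (fun N => \bigcup_(i in [set i | (N <= i)%N]) B i).
Proof.
move=> c0 mB [n0 _ Hn0].
have mU N : measurable (\bigcup_(i in [set i | (N <= i)%N]) B i).
  by apply: bigcup_measurable.
pose q := expR (- c).
have q0 : 0 <= q by exact: expR_ge0.
have q1 : q < 1 by rewrite expR_lt1 oppr_lt0.
split=> //.
have bnd N : (n0 <= N)%N ->
    fine (P (\bigcup_(i in [set i | (N <= i)%N]) B i)) <= q ^+ N / (1 - q).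
  move=> nN; rewrite -lee_fin fineK ?fin_num_measure//.
  have sub : \bigcup_(i in [set i | (N <= i)%N]) B i `<=`
      \bigcup_(i in ~` `I_N) B i.
    by move=> w [i Ni Bi]; exists i => //=; apply/negP; rewrite -leqNgt.
  apply: (le_trans (measure_sigma_subadditive_tail P mB (mU N) sub)).
  apply: lime_le; first exact: is_cvg_nneseries.
  apply: nearW => n.
  rewrite (eq_bigr (fun i => (fine (P (B i)))%:E)); last first.
    by move=> i _; rewrite fineK ?fin_num_measure.
  rewrite sumEFin lee_fin.
  apply: (@le_trans _ _ (\sum_(N <= i < n) q ^+ i)).
    apply: ler_sum_nat => i /andP[Ni _].
    by rewrite (le_trans (Hn0 i (leq_trans nN Ni)))// -expRM_natr mulNr.
  have [nN'|/ltnW Nn] := leqP n N.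
    by rewrite big_geq// divr_ge0 ?exprn_ge0//; lra.
  rewrite ler_pdivlMr ?subr_gt0// -(subnKC Nn).
  have -> k : (\sum_(N <= i < N + k) q ^+ i) * (1 - q) = q ^+ N - q ^+ (N + k).
    elim: k => [|k IH]; first by rewrite addn0 big_geq// mul0r subrr.
    rewrite addnS big_nat_recr ?leq_addr//= mulrDl IH exprS; ring.
  by rewrite lerBlDr lerDl exprn_ge0.
apply: (@squeeze_cvgr _ _ _ _ (fun=> 0) (fun N => q ^+ N / (1 - q))).
- by near=> N; rewrite fine_probability_ge0 bnd//; near: N; exists n0.
- exact: cvg_cst.
- rewrite -[X in _ --> X](mul0r (1 - q)^-1); apply: cvgM; last exact: cvg_cst.
  by apply: cvg_expr; rewrite ger0_norm.
Unshelve. all: by end_near. Qed.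

End vanishing_events.

(** * The urn process *)

Lemma not_bigsetU (T : Type) (A : nat -> set T) n j w : (j < n)%N ->
  ~ (\big[setU/set0]_(0 <= i < n) A i) w -> ~ A j w.
Proof. by move=> jn; rewrite big_mkord -bigcup_mkord => nA Aj; apply: nA; exists j. Qed.

(** The exceptional set has a fixed part [E], chosen once for the irregular thresholds, and a part
    [V n] that vanishes; each receives half of the allowed probability. *)
Lemma cvg_in_probability_criterion d (T : measurableType d) (R : realType)
    (P : probability T R) (Q : nat -> T -> R) (c : R) :
  (forall n, measurable_fun [set: T] (Q n)) ->
  (forall eps delta, 0 < eps -> 0 < delta ->
    exists E V n0, [/\ measurable E, fine (P E) <= delta, vanishing P V &
      forall n w, (n0 <= n)%N -> ~ E w -> ~ V n w -> `|Q n w - c| < eps]) ->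
  cvg_in_probability P Q c.
Proof.
move=> mQ H eps e0.
have mA n : measurable [set w | eps <= `|Q n w - c|].
  apply: measurable_ge; apply: measurableT_comp => //.
  exact: measurable_funB.
have -> : (fun n => P [set w | eps <= `|Q n w - c|]) =
    (fun n => (fine (P [set w | eps <= `|Q n w - c|]))%:E).
  by apply/funext => n; rewrite fineK// fin_num_measure.
apply: cvg_EFin; first exact: nearW.
apply/cvgr0Pnorm_le => delta d0.
have d2 : 0 < delta / 2 by rewrite divr_gt0.
have [E [V [n0 [mE PE [mV V0] HEV]]]] := H eps (delta / 2) e0 d2.
move/cvgr0Pnorm_le : V0 => /(_ _ d2) V0.
near=> n; rewrite /= ger0_norm ?fine_probability_ge0//.
apply: (@le_trans _ _ (fine (P (E `|` V n)))).
  apply: fine_probability_le => //; first exact: measurableU.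
  move=> w /= ew; apply: contrapT => /not_orP[nE nV].
  have nn0 : (n0 <= n)%N by near: n; exact: nbhs_infty_ge.
  by have := HEV n w nn0 nE nV; rewrite ltNge ew.
apply: le_trans (fine_probabilityU P mE (mV n)) _.
rewrite [leRHS]splitr lerD//; apply: le_trans (ler_norm _) _.
by near: n.
Unshelve. all: by end_near. Qed.

(** * Weak law of large numbers for the reinforcements *)

Section sample_mean.
Context d dS (T : measurableType d) (S : measurableType dS) (R : realType)
  (P : probability T R) (mu : probability S R).
Variables (u : S -> R) (xi : nat -> T -> S) (b th : R).
Hypothesis mu_u : measurable_fun [set: S] u.
Hypothesis u_bnd : forall s, 0 <= u s <= b.
Hypothesis mxi : forall n, measurable_fun [set: T] (xi n).
Hypothesis law : forall n B, measurable B -> P (xi n @^-1` B) = mu B.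
Hypothesis ind : forall i l A B, (i < l)%N -> measurable A -> measurable B ->
  P (xi i @^-1` A `&` xi l @^-1` B) = (P (xi i @^-1` A) * P (xi l @^-1` B))%E.

Let bu : bounded_measurable u.
Proof.
split => //; exists b => s; have /andP[u0 ub] := u_bnd s.
by rewrite ger0_norm.
Qed.

Let m := \int[mu]_x u x.

Lemma Rintegral_law n : \int[P]_w u (xi n w) = m.
Proof.
pose X : {mfun T >-> S} := HB.pack (xi n) (isMeasurableFun.Build _ _ _ _ _ (mxi n)).
rewrite /m /Rintegral; congr fine.
transitivity (\int[distribution P X]_x (u x)%:E)%E.
  rewrite integral_distribution//; first exact/measurable_EFinP.
  apply: (@bounded_measurable_integrable _ _ _ P (u \o xi n)).
  split; first exact: measurableT_comp.
  by have [_ [M uM]] := bu; exists M => w; exact: uM.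
by apply: eq_measure_integral => B mB _; exact: law.
Qed.

(** The centred variables are bounded, and pairwise independence makes them orthogonal. *)
Lemma vanishing_sample_mean (j : nat) : 0 < th ->
  vanishing P (fun h =>
    [set w | th * h%:R < `|\sum_(0 <= i < j * h) u (xi i w) - m * (j * h)%:R|]).
Proof.
move=> th0.
have E h w : \sum_(0 <= i < j * h) u (xi i w) - m * (j * h)%:R =
    \sum_(0 <= i < j * h) (u (xi i w) - m).
  by rewrite sumrB sumr_const_nat subn0 mulr_natr.
under eq_fun do under eq_set do rewrite E.
have bui i : bounded_measurable (fun w => u (xi i w)).
  split; first exact: measurableT_comp.
  by have [_ [M uM]] := bu; exists M => w; exact: uM.
have bum i : bounded_measurable (fun w => u (xi i w) - m).
  apply: (@bounded_measurableD _ _ _ _ (fun=> - m)) => //.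
  exact: bounded_measurable_cst.
apply: (@vanishing_orthogonal_sum _ _ _ _
  (fun i w => u (xi i w) - m) (b + `|m|)) => //.
- by move=> i; exact: (bum i).1.
- move=> i w; apply: le_trans (ler_normB _ _) _; rewrite lerD2r.
  by have /andP[u0 ub] := u_bnd (xi i w); rewrite ger0_norm.
move=> i l il; apply: independent_mul_integral0 => //.
  move=> A B mA mB.
  have pre k C : (fun w => u (xi k w) - m) @^-1` C =
    xi k @^-1` ((fun x => u x - m) @^-1` C) by [].
  have mum : measurable_fun [set: S] (fun x => u x - m).
    by apply: measurable_funB => //; exact: measurable_cst.
  have mpre C : measurable C -> measurable ((fun x => u x - m) @^-1` C).
    by move=> mC; rewrite -[X in measurable X]setTI; exact: mum.
  by rewrite !pre ind//; exact: mpre.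
rewrite RintegralB//; [|exact: bounded_measurable_integrable|]; last first.
  exact/bounded_measurable_integrable/bounded_measurable_cst.
rewrite Rintegral_law Rintegral_cst//.
have E1 : fine (P [set: T]) = 1 by rewrite probability_setT.
by rewrite [fine (P setT)]E1 mulr1 subrr.
Qed.

End sample_mean.

(** * Martingale noise, good events and convergence of the urn *)

Section urn_noise.
Context d dS dF (T : measurableType d) (S : measurableType dS)
  (Phi : measurableType dF) (R : realType) (P : probability T R).
Variables (a b : R) (u : S -> R) (xi1 xi2 : nat -> T -> S) (U : nat -> T -> R)
  (phi : nat -> T -> Phi) (rho1hat rho2hat : nat -> T -> R) (y10 y20 : R).
Hypothesis a_gt0 : 0 < a.
Hypothesis mu_u : measurable_fun setT u.
Hypothesis u_bnd : forall s, a <= u s <= b.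
Hypothesis y10_gt0 : 0 < y10.
Hypothesis y20_gt0 : 0 < y20.
Hypothesis mxi1 : forall n, measurable_fun setT (xi1 n).
Hypothesis mxi2 : forall n, measurable_fun setT (xi2 n).
Hypothesis mU : forall n, measurable_fun setT (U n).
Hypothesis mphi : forall n, measurable_fun setT (phi n).
Hypothesis lawU : forall n (B : set R), measurable B ->
  P (U n.+1 @^-1` B) = lebesgue_measure (B `&` `]0, 1[).

(** The index [Some n] stands for the uniform of step [n.+1]. All [xi] and [phi] share the index
    [None], because their joint dependence is not restricted. *)
Definition urn_sources (i : option nat) : set (set T) :=
  match i with
  | Some n => sigma_of (U n.+1)
  | None => <<s \bigcup_(n in [set: nat])
              (sigma_of (xi1 n) `|` sigma_of (xi2 n) `|` sigma_of (phi n)) >>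
  end.

Hypothesis indU : mutually_independent P urn_sources.

Local Notation F := (urnF u xi1 xi2 U rho1hat rho2hat y10 y20 phi).
Local Notation Z := (urnZ u xi1 xi2 U rho1hat rho2hat y10 y20).
Hypothesis Frho1 : forall n (B : set R), measurable B -> F n (rho1hat n @^-1` B).
Hypothesis Frho2 : forall n (B : set R), measurable B -> F n (rho2hat n @^-1` B).

Let u_ge0 s : 0 <= u s.
Proof. by have /andP[au _] := u_bnd s; exact: le_trans (ltW a_gt0) au. Qed.

Let a_le_b : a <= b.
Proof. by have /andP[au ub] := u_bnd point; exact: le_trans au ub. Qed.

Lemma urn_sources_measurable i : urn_sources i `<=` measurable.
Proof.
case: i => [n|]; first exact: sigma_of_measurable.
apply: smallest_sub; first exact: sigma_algebra_measurable.
by move=> A [n _ [[|]|]]; exact: sigma_of_measurable.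
Qed.

Lemma urn_sources_setT i : urn_sources i setT.
Proof.
case: i => [n|]; first exact: sigma_of_setT.
by apply: sub_sigma_algebra; exists 0%N => //; left; left; exact: sigma_of_setT.
Qed.

Lemma urn_sources_setI i : setI_closed (urn_sources i).
Proof.
case: i => [n|]; first exact: setI_closed_sigma_of.
by move=> A B sA sB; exact: (@measurableI _ (g_sigma_algebraType _)).
Qed.

Definition past_index (n : nat) : seq (option nat) :=
  None :: [seq Some k | k <- iota 0 n].

Lemma past_index_uniq n : uniq (past_index n).
Proof.
rewrite /= map_inj_uniq ?iota_uniq ?andbT; last by move=> ? ? [].
by apply/mapP => -[].
Qed.

Lemma mem_past_index n k : (Some k \in past_index n) = (k < n)%N.
Proof.
by rewrite in_cons/= mem_map ?mem_iota//; move=> ? ? [].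
Qed.

(* The past at time n contains U_1, ..., U_n and all the xi and phi, including
   the future ones. *)
Definition pastType (n : nat) :=
  g_sigma_algebraType (cylinders urn_sources (past_index n)).

Lemma past_measurable n i : i \in past_index n ->
  urn_sources i `<=` @measurable _ (pastType n).
Proof.
move=> iJ A GA; apply: sub_sigma_algebra.
exact: (sub_cylinders urn_sources_setT (past_index_uniq n) iJ).
Qed.

Lemma past_source_fun n d' (T' : measurableType d') (X : T -> T') i :
  i \in past_index n -> sigma_of X `<=` urn_sources i ->
  @measurable_fun _ _ (pastType n) T' setT X.
Proof.
move=> iJ XG _ B mB; rewrite setTI; apply: (past_measurable iJ); apply: XG.
by exists B.
Qed.

Lemma past_xi1 n k : @measurable_fun _ _ (pastType n) S setT (xi1 k).
Proof.
apply: (@past_source_fun _ _ _ _ None) => // A sA.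
by apply: sub_sigma_algebra; exists k => //; left; left.
Qed.

Lemma past_xi2 n k : @measurable_fun _ _ (pastType n) S setT (xi2 k).
Proof.
apply: (@past_source_fun _ _ _ _ None) => // A sA.
by apply: sub_sigma_algebra; exists k => //; left; right.
Qed.

Lemma past_phi n k : @measurable_fun _ _ (pastType n) Phi setT (phi k).
Proof.
apply: (@past_source_fun _ _ _ _ None) => // A sA.
by apply: sub_sigma_algebra; exists k => //; right.
Qed.

Lemma past_U n k : (k < n)%N -> @measurable_fun _ _ (pastType n) R setT (U k.+1).
Proof.
by move=> kn; apply: (@past_source_fun _ _ _ _ (Some k)); rewrite ?mem_past_index.
Qed.

(** [measurable_urn] is used with the sigma-algebra of the past on [T] and horizon [n]: the urn up
    to time [n] involves only the first [n] uniforms. *)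
Lemma past_urn n k : (k <= n)%N ->
  [/\ @measurable_fun _ _ (pastType n) R setT (Z k),
      @measurable_fun _ _ (pastType n) R setT (rho1hat k)
    & @measurable_fun _ _ (pastType n) R setT (rho2hat k)].
Proof.
apply: (@measurable_urn _ _ _ (pastType n) S Phi R u xi1 xi2 U phi rho1hat
  rho2hat y10 y20 n) => //.
- exact: past_xi1.
- exact: past_xi2.
- exact: past_phi.
- exact: past_U.
Qed.

Lemma past_sub n : @measurable _ (pastType n) `<=` @measurable _ T.
Proof.
apply: smallest_sub; first exact: sigma_algebra_measurable.
move=> _ [A GA ->]; rewrite big_seq; apply: bigsetI_measurable => i iJ.
exact/urn_sources_measurable/GA.
Qed.

Lemma past_measurable_fun n d' (T' : measurableType d') (X : T -> T') :
  @measurable_fun _ _ (pastType n) T' setT X -> measurable_fun setT X.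
Proof. by move=> mX _ B mB; apply: (@past_sub n); exact: mX. Qed.

Lemma past_independent n A B : @measurable _ (pastType n) A -> measurable B ->
  P (A `&` U n.+1 @^-1` B) = (P A * P (U n.+1 @^-1` B))%E.
Proof.
move=> mA mB; apply: (@cylinders_independent _ _ _ P _ urn_sources indU
  urn_sources_measurable urn_sources_setT urn_sources_setI (past_index n)
  (Some n)) => //.
- exact: past_index_uniq.
- by rewrite mem_past_index ltnn.
- by exists B.
Qed.

Lemma urnZ_in01 n w : 0 <= Z n w <= 1.
Proof.
have y1 : 0 < urnY1 u xi1 xi2 U rho1hat rho2hat y10 y20 n w by exact: urnY1_gt0.
have y2 : 0 < urnY2 u xi1 xi2 U rho1hat rho2hat y10 y20 n w by exact: urnY2_gt0.
rewrite divr_ge0 ?ler_pdivrMr ?mul1r ?lerDl ?addr_gt0 ?addr_ge0 ?ltW//.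
Qed.

(** For [i < l] the product [X i * H l] belongs to the past at time [l], even when [H l] contains
    the reinforcement of step [l.+1], since that past holds all [xi]. The remaining factor is the
    centred indicator of a uniform independent of it, so the terms are orthogonal. *)
Lemma vanishing_noise (H : nat -> T -> R) (C th : R) (j : nat) : 0 < th ->
  (forall i w, `|H i w| <= C) ->
  (forall i n, (i <= n)%N -> @measurable_fun _ _ (pastType n) R setT (H i)) ->
  vanishing P (fun h => [set w | th * h%:R <
    `|\sum_(0 <= i < j * h) ((U i.+1 w <= Z i w)%R%:R - Z i w) * H i w|]).
Proof.
move=> th0 HC mH.
pose X i w := ((U i.+1 w <= Z i w)%R%:R - Z i w) * H i w.
have pX i n : (i < n)%N -> @measurable_fun _ _ (pastType n) R setT (X i).
  move=> il; have [mZ _ _] := past_urn (ltnW il).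
  apply: measurable_funM; last exact: (mH _ _ (ltnW il)).
  apply: measurable_funB => //; apply: measurable_natr_bool.
  exact: (measurable_fun_ler (past_U il) mZ).
have XC i w : `|X i w| <= C.
  rewrite /X normrM -[leRHS]mul1r; apply: ler_pM => //.
  by have := urnZ_in01 i w; case: (U _ _ <= _)%R => /=; rewrite ler_norml; lra.
apply: (@vanishing_orthogonal_sum _ _ _ _ X C) => //.
  by move=> i; exact: (past_measurable_fun (pX i _ (ltnSn i))).
move=> i l il.
have [mZ _ _] := past_urn (leqnn l).
have mK : @measurable_fun _ _ (pastType l) R setT (fun w => X i w * H l w).
  by apply: measurable_funM; [exact: pX|exact: mH].
transitivity
  (\int[P]_w (X i w * H l w * ((U l.+1 w <= Z l w)%R%:R - Z l w))).
  by apply: eq_Rintegral => w _; rewrite /X; ring.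
apply: uniform_threshold_integral0.
- exact: mU.
- exact: past_measurable_fun mZ.
- split; first exact: past_measurable_fun mK.
  by exists (C * C) => w; rewrite normrM; apply: ler_pM.
- exact: lawU.
- exact: urnZ_in01.
move=> A B mA mB; apply: past_independent => //.
have mV : @measurable_fun _ _ (pastType l) (R * R)%type setT
  (fun w => (Z l w, X i w * H l w)) by exact: measurable_fun_pair.
by rewrite -[X in measurable X]setTI; exact: mV.
Qed.

Lemma past_whole n : [/\ measurable_fun [set: T] (Z n),
  measurable_fun [set: T] (rho1hat n) & measurable_fun [set: T] (rho2hat n)].
Proof.
have [mZ m1 m2] := past_urn (leqnn n).
by split; [exact: past_measurable_fun mZ|exact: past_measurable_fun m1|
  exact: past_measurable_fun m2].
Qed.

Local Notation Y1 := (urnY1 u xi1 xi2 U rho1hat rho2hat y10 y20).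
Local Notation Y2 := (urnY2 u xi1 xi2 U rho1hat rho2hat y10 y20).
Local Notation X w := (fun i => (U i.+1 w <= Z i w)%R).
Local Notation W1 w := (fun i => (Z i w <= rho1hat i w)%R).
Local Notation W2 w := (fun i => (rho2hat i w <= Z i w)%R).
Local Notation D1 w := (fun i => u (xi1 i.+1 w)).
Local Notation D2 w := (fun i => u (xi2 i.+1 w)).

Lemma urn_urn_path w :
  urn_path a b (Y1^~ w) (Y2^~ w) (D1 w) (D2 w) (X w) (W1 w) (W2 w).
Proof.
by split=> // i; [exact: urnY1S|exact: urnY2S].
Qed.

Variables (mu1 mu2 : probability S R).
Hypothesis law1 : forall n B, measurable B -> P (xi1 n.+1 @^-1` B) = mu1 B.
Hypothesis law2 : forall n B, measurable B -> P (xi2 n.+1 @^-1` B) = mu2 B.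
Hypothesis indxi : mutually_independent P
  (fun i : bool * nat => sigma_of (if i.1 then xi1 i.2.+1 else xi2 i.2.+1)).
Variables (rmin rmax c rho1 rho2 : R).
Hypothesis rmin_gt0 : 0 < rmin.
Hypothesis rmax_lt1 : rmax < 1.
Hypothesis c_gt0 : 0 < c.
Hypothesis thresholds : \forall n \near \oo,
  ((1 - expR (- (c * n%:R)))%:E <=
   P [set w | (rmin <= rho2hat n w)%R /\ (rho2hat n w <= rho1hat n w)%R
              /\ (rho1hat n w <= rmax)%R])%E.
Hypothesis rho21 : rho2 <= rho1.
Hypothesis cvg1 : cvg_in_probability P rho1hat rho1.
Hypothesis cvg2 : cvg_in_probability P rho2hat rho2.

Let m1 := \int[mu1]_x u x.
Let m2 := \int[mu2]_x u x.

Let regular (n : nat) := [set w | (rmin <= rho2hat n w)%R /\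
  (rho2hat n w <= rho1hat n w)%R /\ (rho1hat n w <= rmax)%R].

Let measurable_regular n : measurable (regular n).
Proof.
have [_ mr1 mr2] := past_whole n.
apply: measurableI; last apply: measurableI.
- exact: measurable_ge.
- by apply: measurable_pred; exact: measurable_fun_ler.
- by apply: measurable_pred; exact: measurable_fun_ler.
Qed.

Lemma irregular_tail :
  vanishing P (fun N => \bigcup_(i in [set i | (N <= i)%N]) ~` regular i).
Proof.
apply: (exponential_tail c_gt0) => [i|]; first exact: measurableC.
move: thresholds; apply: filterS => n.
rewrite probability_setC// -[P (regular n)]fineK ?fin_num_measure//.
by rewrite lee_fin /=; lra.
Qed.

Let vanishing_deviation (r : nat -> T -> R) (r0 e : R) : 0 < e ->
  (forall n, measurable_fun [set: T] (r n)) ->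
  cvg_in_probability P r r0 -> vanishing P (fun n => [set w | e <= `|r n w - r0|]).
Proof.
move=> e0 mr cr; split.
  move=> n; apply: measurable_ge; apply: measurableT_comp => //.
  exact: measurable_funB.
exact: (fine_cvg (cr e e0)).
Qed.

Lemma independent_pair (s : bool) i l A B : (i < l)%N ->
  measurable A -> measurable B ->
  let xi n := if s then xi1 n.+1 else xi2 n.+1 in
  P (xi i @^-1` A `&` xi l @^-1` B) = (P (xi i @^-1` A) * P (xi l @^-1` B))%E.
Proof.
move=> il mA mB xi.
have mxi n : measurable_fun [set: T] (xi n) by rewrite /xi; case: (s).
pose C (k : bool * nat) := if k.2 == i then xi i @^-1` A else xi l @^-1` B.
have Ci : C (s, i) = xi i @^-1` A by rewrite /C eqxx.
have Cl : C (s, l) = xi l @^-1` B by rewrite /C gtn_eqF.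
have := indxi (J := [:: (s, i); (s, l)]) (A := C).
rewrite !big_cons !big_nil /= Ci Cl setIT mulr1 => ->.
- rewrite EFinM !fineK// fin_num_measure//.
    by rewrite -[Q in measurable Q]setTI; exact: mxi.
  by rewrite -[Q in measurable Q]setTI; exact: mxi.
- by rewrite inE xpair_eqE eqxx ltn_eqF.
move=> k; rewrite !inE => /orP[]/eqP ->; rewrite ?Ci ?Cl.
  by exists A.
by exists B.
Qed.

(** The order of choice matters: [N], [p] and [E] depend on [delta] only, since [K] and [th] are
    later chosen from [N] and [p]. Both orientations are provided; with the colours exchanged the
    target is [1 - rho2]. *)
Lemma good_event (delta : R) : 0 < delta -> exists N p E,
  [/\ 0 < p, measurable E, fine (P E) <= delta &
   forall K th e, 0 < th -> 0 < e -> exists2 V, vanishing P V &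
     forall h w, ~ E w -> ~ V h w -> exists bad,
     good_scale (Y1^~ w) (Y2^~ w) (D1 w) (D2 w) (X w) (W1 w) (W2 w) bad
       N h K p e th rho1 m1 m2 /\
     good_scale (Y2^~ w) (Y1^~ w) (D2 w) (D1 w) (fun i => ~~ X w i) (W2 w) (W1 w)
       bad N h K p e th (1 - rho2) m2 m1].
Proof.
move=> delta0.
have [mE E0] := irregular_tail.
move/cvgr0Pnorm_le : E0 => /(_ _ delta0) [N _ HN].
have {HN} := HN N (leqnn N); rewrite /= ger0_norm ?fine_probability_ge0// => PE.
set E := \bigcup_(i in _) _ in PE.
pose y0 := y10 + y20.
have y00 : 0 < y0 by rewrite addr_gt0.
have b0 : 0 < b by exact: lt_le_trans a_gt0 a_le_b.
have q0 : 0 < y0 / (y0 + b) by rewrite divr_gt0// addr_gt0.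
have yN : 0 < y0 + b * N%:R by rewrite ltr_pwDl// mulr_ge0// ltW.
(* These are the bounds of [frac_lower] for red and for white: white is not replenished when the red
   fraction is below [rmin], nor red when it is above [rmax]. *)
pose p1 := Num.min (y10 / (y0 + b * N%:R)) (rmin * (y0 / (y0 + b))).
pose p2 := Num.min (y20 / (y0 + b * N%:R)) ((1 - rmax) * (y0 / (y0 + b))).
have p10 : 0 < p1 by rewrite lt_min divr_gt0// mulr_gt0.
have p20 : 0 < p2 by rewrite lt_min divr_gt0// mulr_gt0// subr_gt0.
exists N, (Num.min p1 p2), E; split => //; [by rewrite lt_min p10|exact: mE|].
move=> K th e th0 e0.
pose H1 i w := u (xi1 i.+1 w) * (W1 w i)%:R.
pose H2 i w := u (xi2 i.+1 w) * (W2 w i)%:R.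
pose A1 j h := [set w | th * h%:R <
  `|\sum_(0 <= i < j * h) ((U i.+1 w <= Z i w)%R%:R - Z i w) * H1 i w|].
pose A2 j h := [set w | th * h%:R <
  `|\sum_(0 <= i < j * h) ((U i.+1 w <= Z i w)%R%:R - Z i w) * H2 i w|].
pose A3 j h := [set w | th * h%:R <
  `|\sum_(0 <= i < j * h) u (xi1 i.+1 w) - m1 * (j * h)%:R|].
pose A4 j h := [set w | th * h%:R <
  `|\sum_(0 <= i < j * h) u (xi2 i.+1 w) - m2 * (j * h)%:R|].
pose B i := [set w | e <= `|rho1hat i w - rho1|] `|`
  [set w | e <= `|rho2hat i w - rho2|].
pose A5 h := [set w | th * h%:R < \sum_(0 <= i < K * h) \1_(B i) w].
have uw s : `|u s| <= b by rewrite ger0_norm//; case/andP: (u_bnd s).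
have u0b s : 0 <= u s <= b by rewrite u_ge0; case/andP: (u_bnd s).
have vA1 j : vanishing P (A1 j).
  apply: (@vanishing_noise H1 b) => //.
    move=> i w; rewrite /H1; case: (W1 w i); first by rewrite mulr1.
    by rewrite mulr0 normr0 ltW.
  move=> i n le_in; have [mZ mr1 mr2] := past_urn le_in.
  apply: (@measurable_funM _ (pastType n) R setT (fun w => u (xi1 i.+1 w))).
    exact: (measurableT_comp mu_u (@past_xi1 n i.+1)).
  by apply: measurable_natr_bool; exact: measurable_fun_ler.
have vA2 j : vanishing P (A2 j).
  apply: (@vanishing_noise H2 b) => //.
    move=> i w; rewrite /H2; case: (W2 w i); first by rewrite mulr1.
    by rewrite mulr0 normr0 ltW.
  move=> i n le_in; have [mZ mr1 mr2] := past_urn le_in.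
  apply: (@measurable_funM _ (pastType n) R setT (fun w => u (xi2 i.+1 w))).
    exact: (measurableT_comp mu_u (@past_xi2 n i.+1)).
  by apply: measurable_natr_bool; exact: measurable_fun_ler.
have vA3 j : vanishing P (A3 j).
  apply: (@vanishing_sample_mean _ _ _ _ _ P mu1 u (fun n => xi1 n.+1) b) => //.
  by move=> i l A C; exact: (@independent_pair true).
have vA4 j : vanishing P (A4 j).
  apply: (@vanishing_sample_mean _ _ _ _ _ P mu2 u (fun n => xi2 n.+1) b) => //.
  by move=> i l A C; exact: (@independent_pair false).
have vB : vanishing P B.
  by apply: vanishingU; apply: vanishing_deviation => // n; have [] := past_whole n.
have vA5 : vanishing P A5 by exact: vanishing_occupation.
(* The range [K.+1] covers all block ends, from 0 to [K * h] included. *)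
exists (fun h => \big[setU/set0]_(0 <= j < K.+1)
  (((A1 j h `|` A2 j h) `|` A3 j h) `|` A4 j h) `|` A5 h).
  apply: vanishingU => //.
  apply: (vanishing_bigU _
    (A := fun j h => ((A1 j h `|` A2 j h) `|` A3 j h) `|` A4 j h)) => j.
  by do 3 apply: vanishingU => //.
move=> h w nE /not_orP[nA nA5].
exists (fun i => w \in B i).
have Hp := urn_urn_path w.
have reg i : (N <= i)%N -> [/\ rmin <= rho2hat i w,
    rho2hat i w <= rho1hat i w & rho1hat i w <= rmax].
  move=> Ni; apply: contrapT => nr; apply: nE; exists i => //.
  by move=> [? [? ?]]; apply: nr; split.
have nAj j : (j <= K)%N -> [/\ ~ A1 j h w, ~ A2 j h w, ~ A3 j h w & ~ A4 j h w].
  move=> jK; have := not_bigsetU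
    (A := fun j => ((A1 j h `|` A2 j h) `|` A3 j h) `|` A4 j h) _ nA.
  move=> /(_ j jK) /not_orP[/not_orP[/not_orP[? ?] ?] ?]; by split.
have z1 i : (N <= i)%N -> p1 <= Z i w.
  apply: (frac_lower Hp rmin_gt0) => k Nk /= zr.
  by have [r1 _ _] := reg k Nk; rewrite -ltNge; exact: lt_le_trans r1.
have z2 i : (N <= i)%N -> p2 <= 1 - Z i w.
  move=> Ni; rewrite -(frac_swap Hp).
  have := @frac_lower _ _ _ _ _ _ _ _ _ _ (urn_path_swap Hp) N (1 - rmax) _ _ i Ni.
  rewrite /= [Y2 0%N w + _]addrC; apply; first by rewrite subr_gt0.
  move=> k Nk; rewrite (frac_swap Hp) -ltNge ltrD2l ltrN2.
  by have [_ _ r3] := reg k Nk; exact: le_lt_trans r3.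
have noise1E n : noise (Y1^~ w) (Y2^~ w) (D1 w) (X w) (W1 w) n =
    \sum_(0 <= i < n) ((U i.+1 w <= Z i w)%R%:R - Z i w) * H1 i w.
  by apply: eq_bigr => i _; rewrite mulrA.
(* The centred indicators of a white and of a red draw are opposite, hence the sign. *)
have noise2E n : noise (Y2^~ w) (Y1^~ w) (D2 w) (fun i => ~~ X w i) (W2 w) n =
    - \sum_(0 <= i < n) ((U i.+1 w <= Z i w)%R%:R - Z i w) * H2 i w.
  rewrite -sumrN; apply: eq_bigr => i _.
  rewrite (frac_swap Hp) mulrA -!mulNr; congr (_ * _ * _).
  by rewrite -/(Z i w); case: (U _ _ <= _)%R => /=; lra.
have occ : \sum_(0 <= i < K * h) ((w \in B i)%:R : R) <= th * h%:R.
  by rewrite leNgt; apply/negP => lt; apply: nA5; rewrite /A5/=.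
have good i : w \notin B i ->
    `|rho1hat i w - rho1| < e /\ `|rho2hat i w - rho2| < e.
  by move/negP; rewrite inE => /not_orP[/= /negP + /negP]; rewrite -!ltNge.
have N1 j : (j <= K)%N ->
    `|noise (Y1^~ w) (Y2^~ w) (D1 w) (X w) (W1 w) (j * h)| <= th * h%:R.
  by move=> /nAj[nA1 _ _ _]; rewrite noise1E leNgt; exact/negP.
have N2 j : (j <= K)%N ->
    `|noise (Y2^~ w) (Y1^~ w) (D2 w) (fun i => ~~ X w i) (W2 w) (j * h)| <= th * h%:R.
  by move=> /nAj[_ nA2 _ _]; rewrite noise2E normrN leNgt; exact/negP.
have S1 j : (j <= K)%N ->
    `|\sum_(0 <= i < j * h) D1 w i - m1 * (j * h)%:R| <= th * h%:R.
  by move=> /nAj[_ _ nA3 _]; rewrite leNgt; exact/negP.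
have S2 j : (j <= K)%N ->
    `|\sum_(0 <= i < j * h) D2 w i - m2 * (j * h)%:R| <= th * h%:R.
  by move=> /nAj[_ _ _ nA4]; rewrite leNgt; exact/negP.
(* A fraction above the upper threshold is also above the lower one. *)
have ww i : (N <= i)%N -> W1 w i || W2 w i.
  move=> Ni; have [_ r2 _] := reg i Ni.
  by case: leP => //= lt; apply: le_trans r2 (ltW lt).
have r21 := rho21.
have fZ i : frac (Y1^~ w) (Y2^~ w) i = Z i w by [].
have min1 : Num.min p1 p2 <= p1 by rewrite ge_min lexx.
have min2 : Num.min p1 p2 <= p2 by rewrite ge_min lexx orbT.
split; split => //.
- move=> i Ni; have := z1 i Ni; have := z2 i Ni; rewrite fZ => ? ?.
  by apply/andP; split; lra.
- by move=> i /good[]; rewrite ltr_norml fZ => /andP[? ?] _ ?; lra.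
- move=> i /good[]; rewrite !ltr_norml fZ => /andP[? ?] /andP[? ?] ?.
  by rewrite -ltNge; apply/andP; split; lra.
- move=> i Ni; have := z1 i Ni; have := z2 i Ni; rewrite (frac_swap Hp) fZ => ? ?.
  by apply/andP; split; lra.
- by move=> i /ww; rewrite orbC.
- by move=> j /N1; congr (`|_| <= _); apply: eq_bigr => i _; rewrite negbK.
- by move=> i /good[_]; rewrite ltr_norml (frac_swap Hp) fZ => /andP[? ?] ?; lra.
- move=> i /good[]; rewrite !ltr_norml (frac_swap Hp) fZ => /andP[? ?] /andP[? ?] ?.
  by rewrite -ltNge; apply/andP; split; lra.
Qed.

Let cvg_div (K : nat) : (0 < K)%N -> (fun n => n %/ K)%N @ \oo --> \oo.
Proof.
move=> K0; apply/cvgnyPge => A; near=> n; rewrite leq_divRL//.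
by near: n; exact: nbhs_infty_ge.
Unshelve. all: by end_near. Qed.

(** The time [n] is cut into [K] blocks of length [n %/ K]. First [delta] gives [N] and [p], these
    give [K] and [th], and only then is the vanishing event taken, along [n %/ K]. *)
Lemma urnZ_cvg_rho1 : m2 < m1 -> cvg_in_probability P Z rho1.
Proof.
move=> m21; apply: cvg_in_probability_criterion.
  by move=> n; have [] := past_whole n.
move=> eps delta eps0 delta0.
have [N [p [E [p0 mE PE HE]]]] := good_event delta0.
(* The path estimate yields a distance of four times this value, strictly below [eps]. *)
have e0 : 0 < eps / 5 by rewrite divr_gt0.
have [K [th [h0 [K0 th0 HK]]]] :=
  frac_near_target_uniform (y10 + y20) N a_gt0 a_le_b p0 e0 m21.
have [V vV HV] := HE K th (eps / 5) th0 e0.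
exists E, (fun n => V (n %/ K)%N), (h0 * K)%N; split => //.
  exact: (vanishing_comp (cvg_div K0) vV).
move=> n w hn nE nV; have [bad [Hg _]] := HV _ _ nE nV.
apply: le_lt_trans (HK _ n _ _ _ _ _ _ _ _ _ _ _ _ (urn_urn_path w) Hg) _ => //.
- by rewrite leq_divRL.
- by rewrite mulnC leq_trunc_div /= addnC -mulSn ltn_ceil.
- by lra.
Qed.

Lemma urnZ_cvg_rho2 : m1 < m2 -> cvg_in_probability P Z rho2.
Proof.
move=> m12; apply: cvg_in_probability_criterion.
  by move=> n; have [] := past_whole n.
move=> eps delta eps0 delta0.
have [N [p [E [p0 mE PE HE]]]] := good_event delta0.
have e0 : 0 < eps / 5 by rewrite divr_gt0.
have [K [th [h0 [K0 th0 HK]]]] :=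
  frac_near_target_uniform (y10 + y20) N a_gt0 a_le_b p0 e0 m12.
have [V vV HV] := HE K th (eps / 5) th0 e0.
exists E, (fun n => V (n %/ K)%N), (h0 * K)%N; split => //.
  exact: (vanishing_comp (cvg_div K0) vV).
move=> n w hn nE nV; have [bad [_ Hg]] := HV _ _ nE nV.
(* Passing to the white fraction turns the target [rho2] into [1 - rho2], and white now has the
   larger mean. *)
have -> : `|Z n w - rho2| = `|frac (Y2^~ w) (Y1^~ w) n - (1 - rho2)|.
  have fZ : frac (Y1^~ w) (Y2^~ w) n = Z n w by [].
  by rewrite (frac_swap (urn_urn_path w)) fZ distrC; congr `|_|; ring.
apply: le_lt_trans (HK _ n _ _ _ _ _ _ _ _ _ _ _ _
  (urn_path_swap (urn_urn_path w)) Hg) _ => //.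
- by rewrite leq_divRL.
- by rewrite mulnC leq_trunc_div /= addnC -mulSn ltn_ceil.
- by rewrite addrC.
- by lra.
Qed.

End urn_noise.

(** Links the extended-real means of the theorem with the real integrals used in the estimates. *)
Lemma bounded_integral_fine d (S : measurableType d) (R : realType)
    (mu : probability S R) (u : S -> R) (a b : R) :
  measurable_fun setT u -> (forall s, a <= u s <= b) ->
  (\int[mu]_x (u x)%:E)%E = (\int[mu]_x u x)%:E.
Proof.
move=> mu_u u_bnd; rewrite /Rintegral fineK//.
apply: integrable_fin_num => //; apply: bounded_measurable_integrable.
split => //; exists (`|a| + `|b|) => s; have /andP[au ub] := u_bnd s.
have := ler_norm b; have := ler_norm (- a); rewrite normrN ler_norml.
have := normr_ge0 a; have := normr_ge0 b; lra.
Qed.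

Unset Implicit Arguments.
Set Strict Implicit.

Theorem theorem2p1
  (d dS dF : measure_display) (T : measurableType d) (S : measurableType dS)
  (Phi : measurableType dF) (R : realType) (P : probability T R)
  (a b : R) (u : S -> R) (mu1 mu2 : probability S R)
  (xi1 xi2 : nat -> T -> S) (U : nat -> T -> R) (phi : nat -> T -> Phi)
  (rho1hat rho2hat : nat -> T -> R) (y10 y20 : R)
  (rho1 rho2 : R) :
  (* urn parameters *)
  0 < a -> a <= b -> measurable_fun setT u -> (forall s, a <= u s <= b) ->
  0 < y10 -> 0 < y20 ->
  (* measurability of the basic random variables *)
  (forall n, measurable_fun setT (xi1 n)) ->
  (forall n, measurable_fun setT (xi2 n)) ->
  (forall n, measurable_fun setT (U n)) ->
  (forall n, measurable_fun setT (phi n)) ->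
  (* laws: xi_{j,n} ~ mu_j, U_n ~ uniform(0,1)  (n >= 1) *)
  (forall n B, measurable B -> P (xi1 n.+1 @^-1` B) = mu1 B) ->
  (forall n B, measurable B -> P (xi2 n.+1 @^-1` B) = mu2 B) ->
  (forall n (B : set R), measurable B ->
     P (U n.+1 @^-1` B) = lebesgue_measure (B `&` `]0, 1[)) ->
  (* the xi_{1,n}, xi_{2,n} (n >= 1) are mutually independent *)
  mutually_independent P
    (fun i : bool * nat =>
       sigma_of (if i.1 then xi1 i.2.+1 else xi2 i.2.+1)) ->
  (* the U_n (n >= 1) are mutually independent, and independent of
     (the xi's, the phi's) *)
  mutually_independent P
    (fun i : option nat =>
       match i with
       | Some n => sigma_of (U n.+1)
       | None => <<s \bigcup_(n in [set: nat])
                   (sigma_of (xi1 n) `|` sigma_of (xi2 n)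
                    `|` sigma_of (phi n)) >>
       end) ->
  (* thresholds: [0,1]-valued, F_n-measurable, rho1hat >= rho2hat a.s. *)
  (forall n w, 0 <= rho1hat n w <= 1) ->
  (forall n w, 0 <= rho2hat n w <= 1) ->
  (forall n (B : set R), measurable B ->
     urnF u xi1 xi2 U rho1hat rho2hat y10 y20 phi n (rho1hat n @^-1` B)) ->
  (forall n (B : set R), measurable B ->
     urnF u xi1 xi2 U rho1hat rho2hat y10 y20 phi n (rho2hat n @^-1` B)) ->
  (forall n, P [set w | rho2hat n w <= rho1hat n w] = 1%E) ->
  (* exponential bound *)
  (exists rmin rmax c : R,
     [/\ 0 < rmin, rmin <= rmax, rmax < 1, 0 < c &
      \forall n \near \oo,
        ((1 - expR (- (c * n%:R)))%:E <=
         P [set w | (rmin <= rho2hat n w)%R /\ (rho2hat n w <= rho1hat n w)%R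
                    /\ (rho1hat n w <= rmax)%R])%E]) ->
  (* limits of the thresholds *)
  0 < rho1 < 1 -> 0 < rho2 < 1 -> rho2 <= rho1 ->
  cvg_in_probability P rho1hat rho1 ->
  cvg_in_probability P rho2hat rho2 ->
  let m1 := (\int[mu1]_x (u x)%:E)%E in
  let m2 := (\int[mu2]_x (u x)%:E)%E in
  m1 != m2 ->
  ((m2 < m1)%E ->
     cvg_in_probability P (urnZ u xi1 xi2 U rho1hat rho2hat y10 y20) rho1) /\
  ((m1 < m2)%E ->
     cvg_in_probability P (urnZ u xi1 xi2 U rho1hat rho2hat y10 y20) rho2).
Proof.
move=> a0 ab mu_u u_bnd y1 y2 mxi1 mxi2 mU mphi law1 law2 lawU indxi indU _ _.
move=> F1 F2 _ [rmin [rmax [c [rmin0 _ rmax1 c0 thresholds]]]] _ _ rho21 cvg1 cvg2.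
move=> m1 m2 _.
have -> : m1 = (\int[mu1]_x u x)%:E by exact: bounded_integral_fine u_bnd.
have -> : m2 = (\int[mu2]_x u x)%:E by exact: bounded_integral_fine u_bnd.
rewrite !lte_fin; split => m12.
- exact: (urnZ_cvg_rho1 a0 mu_u u_bnd y1 y2 mxi1 mxi2 mU mphi lawU indU F1 F2
    law1 law2 indxi rmin0 rmax1 c0 thresholds rho21 cvg1 cvg2 m12).
- exact: (urnZ_cvg_rho2 a0 mu_u u_bnd y1 y2 mxi1 mxi2 mU mphi lawU indU F1 F2
    law1 law2 indxi rmin0 rmax1 c0 thresholds rho21 cvg1 cvg2 m12).
Qed.
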